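(* Let $X=\mathbb{R}$ or $X=\mathbb{S}$, and let $f:\mathbb{R}\to\mathbb{R}$ be a differentiable function which does not change sign and satisfies $f(x)=0$ if and only if $x=0$. Let $u_0\in H^4(X)$, and let $u\in C^0([0,T);H^4(X))\cap C^1([0,T);H^3(X))$ be the corresponding unique solution, with lifespan $T$, of the Cauchy problem $$u_t-u_{txx}+\partial_x f(u)=0,\quad t>0,\ x\in X,\qquad u(0,x)=u_0(x),\quad x\in X.$$ If there exists a non-empty open set $\Omega\subset[0,T)\times X$ such that $u(t,x)=0$ for every $(t,x)\in\Omega$, then $u\equiv 0$ in $[0,T)\times X$.
   Context: $\mathbb{S}=\mathbb{R}/\mathbb{Z}$ is the circle (periodic problem), identified with $[0,1)$; $X=\mathbb{R}$ is the real problem. $H^s(X)$ is the usual $L^2$-based Sobolev space of real-valued functions. ''$f$ does not change sign'' means that either $f\ge 0$ on $\mathbb{R}$ or $f\le 0$ on $\mathbb{R}$. The lifespan $T\in(0,\infty]$ is the maximal time of existence of the solution. The Cauchy problem is equivalent to $u_t=-\partial_x\Lambda^{-2}f(u)$, $u(0)=u_0$, where $\Lambda^{-2}=(1-\partial_x^2)^{-1}$, i.e. $\Lambda^{-2}\phi=g\ast\phi$ with $g(x)=e^{-|x|}/2$ if $X=\mathbb{R}$ and $g(x)=\cosh(x-\lfloor x\rfloor-1/2)/(2\sinh(1/2))$ if $X=\mathbb{S}$. Open means open in the (relative) topology of $[0,T)\times X$. *)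

(* Defs.v *)
From HB Require Import structures.
From mathcomp Require Import all_boot all_order all_algebra.
From mathcomp Require Import all_classical all_reals all_analysis.

Set Implicit Arguments.
Unset Strict Implicit.
Unset Printing Implicit Defensive.

Import Order.TTheory GRing.Theory Num.Theory.
Import numFieldNormedType.Exports.

Local Open Scope classical_set_scope.
Local Open Scope ring_scope.

(* Line is the real line and Circle is R/Z. Functions on the circle are
   represented by their 1-periodic lifts R -> R, integrated over [0, 1). *)
Inductive spatial_domain : Set := Line | Circle.

Definition on_space (R : realType) (X : spatial_domain) (f : R -> R) : Prop :=
  match X with Line => True | Circle => periodic f 1 end.

Definition space_measure (R : realType) (X : spatial_domain) :
    {measure set (measurableTypeR R) -> \bar R} :=
  match X with
  | Line => lebesgue_measure
  | Circle => mrestr lebesgue_measure (measurable_itv `[(0 : R), 1[%R)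
  end.

Definition smooth (R : realType) (phi : R -> R) : Prop :=
  forall (n : nat) (x : R), derivable (derive1n n phi) x 1.

(* Every function on the circle has compact support. *)
Definition test_function (R : realType) (X : spatial_domain) (phi : R -> R) : Prop :=
  [/\ smooth phi, on_space X phi &
      match X with
      | Line => exists M : R, forall x, M < `|x| -> phi x = 0
      | Circle => True
      end].

Definition L2 (R : realType) (X : spatial_domain) : set (R -> R) :=
  [set f | on_space X f /\ f \in Lfun (space_measure R X) 2%:E].

Definition is_weak_derivative (R : realType) (X : spatial_domain) (k : nat)
    (f g : R -> R) : Prop :=
  L2 X g /\
  forall phi : R -> R, test_function X phi ->
    \int[space_measure R X]_x (f x * derive1n k phi x) =
    (-1) ^+ k * \int[space_measure R X]_x (g x * phi x).

(* The Sobolev space H^s(X) for a natural number s, as a set of representatives: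
   equality almost everywhere is not quotiented out. *)
Definition Sobolev (R : realType) (X : spatial_domain) (s : nat) : set (R -> R) :=
  [set f | L2 X f /\
    forall k : nat, (k <= s)%N -> exists g, is_weak_derivative X k f g].

(* The weak derivative is unique almost everywhere, so the choice made by xget
   does not affect the norm below. *)
Definition weak_derivative (R : realType) (X : spatial_domain) (k : nat)
    (f : R -> R) : R -> R :=
  xget (cst 0) [set g | is_weak_derivative X k f g].

(* The H^s norm; it is meaningful on Sobolev X s only. *)
Definition Sobolev_norm (R : realType) (X : spatial_domain) (s : nat) (f : R -> R) : R :=
  Num.sqrt (\sum_(k < s.+1)
    (fine ('N[space_measure R X]_2%:E
             [EFin \o weak_derivative X k f])%E) ^+ 2).

(* The time interval [0, T), with T possibly infinite. *)
Definition lifetime (R : realType) (T : \bar R) : set R :=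
  [set t | 0 <= t /\ (t%:E < T)%E].

Definition C0_Sobolev (R : realType) (X : spatial_domain) (s : nat) (T : \bar R)
    (u : R -> R -> R) : Prop :=
  (forall t, lifetime T t -> Sobolev X s (u t)) /\
  (forall t0, lifetime T t0 ->
    Sobolev_norm X s (fun x => u t x - u t0 x)
      @[t --> within (lifetime T) (nbhs t0)] --> (0 : R)).

(* The derivative in time is the limit, in the H^s norm, of the difference
   quotients within [0, T); it is one-sided at 0. *)
Definition C1_Sobolev (R : realType) (X : spatial_domain) (s : nat) (T : \bar R)
    (u : R -> R -> R) : Prop :=
  C0_Sobolev X s T u /\
  exists du : R -> R -> R,
    C0_Sobolev X s T du /\
    (forall t0, lifetime T t0 ->
      Sobolev_norm X s (fun x => (t - t0)^-1 * (u t x - u t0 x) - du t0 x)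
        @[t --> within (lifetime T) t0^'] --> (0 : R)).

(* Each u(t) is the continuous representative of its class in H^4. By Sobolev
   embedding u(t) is then C^3 in x, the time derivative u_t exists pointwise
   and is C^2 in x, so the equation is an identity between classical partial
   derivatives, namely u_t, u_txx and (f o u)_x. *)
Definition is_solution (R : realType) (X : spatial_domain) (f u0 : R -> R) (T : \bar R)
    (u : R -> R -> R) : Prop :=
  [/\ (0 < T)%E,
      C0_Sobolev X 4 T u /\ C1_Sobolev X 3 T u,
      forall t, lifetime T t -> continuous (u t),
      forall t x, 0 < t -> (t%:E < T)%E ->
        let u_t := fun y => derive1 (fun t' => u t' y) t in
        u_t x - derive1n 2 u_t x + derive1 (f \o u t) x = 0 &
      forall x, u 0 x = u0 x].

(* u is the unique solution with datum u0 and T is its lifespan: any solution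
   with the same datum lives on a subinterval of [0, T), where it equals u. *)
Definition is_unique_maximal_solution (R : realType) (X : spatial_domain)
    (f u0 : R -> R) (T : \bar R) (u : R -> R -> R) : Prop :=
  is_solution X f u0 T u /\
  forall (T' : \bar R) (v : R -> R -> R), is_solution X f u0 T' v ->
    (T' <= T)%E /\ (forall t x, lifetime T' t -> v t x = u t x).

(* Relatively open subsets of [0, T) x X. A subset of [0, T) x R/Z is represented
   by its preimage in [0, T) x R, and it is open iff that preimage is. *)
Definition open_in_spacetime (R : realType) (X : spatial_domain) (T : \bar R)
    (Omega : set (R * R)) : Prop :=
  (exists O : set (R * R), open O /\ Omega = O `&` (lifetime T `*` setT)) /\
  match X with
  | Line => True
  | Circle => forall t x, Omega (t, x + 1) <-> Omega (t, x)
  end.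

(* Main.v *)
(* On the vanishing set, both w = u_t and p = f(u) vanish near a point c, at a
   fixed time t0 > 0, and w - w_xx + p_x = 0 on the whole line. Instead of
   using the kernel of (1 - d_x^2)^(-1), integrate the equation against e^(-x)
   to the right of c and against e^x to its left: the boundary terms vanish at
   c and at infinity, so the integral of e^(-|x|) p vanishes on each side, and
   p = 0 because it has a constant sign. Hence u(t0) = 0. The H^1 energy of u
   over a large interval then changes only through a flux at its endpoints,
   which tends to 0 locally uniformly in time on the line and cancels by
   periodicity on the circle; so the energy is conserved, and u = 0 at all
   times, both after and before t0.

   The classical derivatives in the equation come from the weak ones: testing
   against smooth trapezoids shows that f(b) - f(a) is the integral of the weak
   derivative at Lebesgue points a < b of f, which yields continuous
   representatives and sup-norm bounds by the Sobolev norm. *)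
Require Import Defs.
From HB Require Import structures.
From mathcomp Require Import all_boot all_order all_algebra.
From mathcomp Require Import all_classical all_reals all_analysis.
From mathcomp Require Import measurable_realfun ring lra.

Set Implicit Arguments.
Unset Strict Implicit.
Unset Printing Implicit Defensive.

Import Order.TTheory GRing.Theory Num.Theory.
Import numFieldNormedType.Exports.

Local Open Scope classical_set_scope.
Local Open Scope ring_scope.

(** * Smooth cutoff functions *)

(** Lifts of functions on the circle are bounded functions on the line, so the integration against
    exponentials serves both spaces at once: at infinity it asks only that w, w_x and p be bounded.
    Decay enters only through the energy flux on the line. Since [f] is merely differentiable, f'
    may fail to be integrable. The derivative of f o u is therefore always taken from the equation,
    as the continuous function w_xx - w, and u (f o u)_x is recognised as the derivative of u f(u) -
    F(u), where F is a primitive of [f]. The open set may touch time 0, where the equation is not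
    imposed and the time derivative is one-sided. The argument works at interior times and recovers
    time 0 at the end by continuity. The energy is taken over bounded intervals because the time
    quotients of u and u_x are controlled in sup norm, and such control passes under an integral
    over a set of finite measure. *)

Lemma is_derive1P (R : realType) (f : R -> R) (x d : R) :
  is_derive x 1 f d <-> derivable f x 1 /\ derive1 f x = d.
Proof.
by split=> [[df <-]|[df <-]]; [split; rewrite ?derive1E|split; rewrite ?derive1E].
Qed.

Lemma is_derive1_ext (R : realType) (f g : R -> R) :
  (forall x : R, is_derive x 1 f (g x)) -> derive1 f = g.
Proof. by move=> fg; apply/funext => x; have /is_derive1P[] := fg x. Qed.

Lemma is_derive1_chain (R : realType) (f g : R -> R) (x df dg : R) :
  is_derive x 1 f df -> is_derive (f x) 1 g dg ->
  is_derive x 1 (fun y => g (f y)) (dg * df).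
Proof.
by move=> f1 g1; exact: (@is_derive1_comp _ g f).
Qed.

Lemma is_derive1_continuous (R : realType) (f : R -> R) (x d : R) :
  is_derive x 1 f d -> {for x, continuous f}.
Proof. by case=> df _; apply/differentiable_continuous/derivable1_diffP. Qed.

(** Finite orders replace [smooth] so that closure under products and inverses goes by induction:
    order [n.+1] of a product rests on order [n] of its factors and of their derivatives. *)
Definition diffn (R : realType) (n : nat) (f : R -> R) : Prop :=
  forall k x, (k < n)%N -> derivable (derive1n k f) x 1.

Lemma diffn0 (R : realType) (f : R -> R) : diffn 0 f.
Proof. by move=> k x; rewrite ltn0. Qed.

Lemma smooth_diffn (R : realType) (f : R -> R) :
  smooth f <-> forall n, diffn n f.
Proof. by split=> [sf n k x _ |sf n x]; [exact: sf|exact: (sf n.+1)]. Qed.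

Lemma diffnS (R : realType) (n : nat) (f g : R -> R) :
  (forall x : R, is_derive x 1 f (g x)) -> (diffn n.+1 f <-> diffn n g).
Proof.
move=> fg; have Dfg := is_derive1_ext fg; split=> [df k x kn|dg [|k] x kn].
- by rewrite -Dfg -derive1Sn; apply: df.
- by have /is_derive1P[] := fg x.
- by rewrite derive1Sn Dfg; apply: dg.
Qed.

Lemma diffnS_ex (R : realType) (n : nat) (f : R -> R) :
  diffn n.+1 f -> exists2 g, (forall x : R, is_derive x 1 f (g x)) & diffn n g.
Proof.
move=> df; have fg (x : R) : is_derive x 1 f (derive1 f x).
  by apply/is_derive1P; split=> //; exact: (df 0).
by exists (derive1 f) => //; apply/(diffnS n fg).
Qed.

Lemma diffnW (R : realType) (n : nat) (f : R -> R) : diffn n.+1 f -> diffn n f.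
Proof. by move=> df k x kn; apply: df; rewrite ltnS ltnW. Qed.

Lemma is_derive1D (R : realType) (f g : R -> R) (x df dg : R) :
  is_derive x 1 f df -> is_derive x 1 g dg ->
  is_derive x 1 (fun y => f y + g y) (df + dg).
Proof. by move=> f1 g1; exact: (@is_deriveD _ _ _ f g). Qed.

Lemma is_derive1N (R : realType) (f : R -> R) (x df : R) :
  is_derive x 1 f df -> is_derive x 1 (fun y => - f y) (- df).
Proof. by move=> f1; exact: (@is_deriveN _ _ _ f). Qed.

Lemma is_derive1B (R : realType) (f g : R -> R) (x df dg : R) :
  is_derive x 1 f df -> is_derive x 1 g dg ->
  is_derive x 1 (fun y => f y - g y) (df - dg).
Proof. by move=> f1 g1; apply: is_derive1D => //; exact: is_derive1N. Qed.

Lemma diffnD (R : realType) (n : nat) (f g : R -> R) :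
  diffn n f -> diffn n g -> diffn n (fun x => f x + g x).
Proof.
elim: n f g => [|n IH] f g; first by move=> *; exact: diffn0.
move=> /diffnS_ex[f' ff' df] /diffnS_ex[g' gg' dg].
have D (x : R) : is_derive x 1 (fun x => f x + g x) (f' x + g' x).
  exact: is_derive1D.
by apply/(diffnS n D); apply: IH.
Qed.

Lemma is_derive1M (R : realType) (f g : R -> R) (x df dg : R) :
  is_derive x 1 f df -> is_derive x 1 g dg ->
  is_derive x 1 (fun y => f y * g y) (df * g x + f x * dg).
Proof.
move=> f1 g1; apply: (is_derive_eq (@is_deriveM _ _ f g x 1 df dg f1 g1)).
by rewrite /GRing.scale/= addrC mulrC.
Qed.

Lemma diffnM (R : realType) (n : nat) (f g : R -> R) :
  diffn n f -> diffn n g -> diffn n (fun x => f x * g x).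
Proof.
elim: n f g => [|n IH] f g; first by move=> *; exact: diffn0.
move=> df dg.
have [f' ff' df'] := diffnS_ex df; have [g' gg' dg'] := diffnS_ex dg.
have D x := is_derive1M (ff' x) (gg' x).
apply/(diffnS n D); apply: diffnD.
  exact: IH df' (diffnW dg).
exact: IH (diffnW df) dg'.
Qed.

Lemma diffn_cst (R : realType) (n : nat) (c : R) : diffn n (fun _ : R => c).
Proof.
elim: n c => [|n IH] c; first exact: diffn0.
by apply/(@diffnS R n _ (fun=> 0)) => // x; exact: is_derive_cst.
Qed.

(** The derivative of the inverse contains the inverse again, but at one order less; hence the
    induction on the order with [f] fixed. *)
Lemma diffnV (R : realType) (n : nat) (f : R -> R) : (forall x, f x != 0) ->
  diffn n f -> diffn n (fun x => (f x)^-1).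
Proof.
move=> f0; elim: n => [|n IH] df; first exact: diffn0.
have [f' ff' df'] := diffnS_ex df.
have D (x : R) : is_derive x 1 (fun x => (f x)^-1) (-1 * ((f x)^-1 * (f x)^-1 * f' x)).
  have [ff <-] := ff' x; apply: DeriveDef; first exact: derivableV.
  by rewrite deriveV// scaleNr mulN1r expr2 invfM.
have dV := IH (diffnW df).
apply/(diffnS n D); apply: diffnM; first exact: diffn_cst.
by apply: diffnM df'; exact: diffnM.
Qed.

Lemma is_derive1_affine (R : realType) (f : R -> R) (x a b d : R) :
  is_derive (a * x + b) 1 f d -> is_derive x 1 (fun y => f (a * y + b)) (a * d).
Proof.
rewrite [a * d]mulrC => fd.
suff h : is_derive x 1 (fun y => a * y + b) a.
  by have := @is_derive1_chain _ (fun y => a * y + b) f _ _ _ h fd; apply.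
have h := @is_derive1D _ _ _ _ _ _ (@is_derive1M _ _ _ _ _ _
  (is_derive_cst a x 1) (is_derive_id x 1)) (is_derive_cst b x 1).
by apply: (is_derive_eq h); rewrite mul0r mulr1 add0r addr0.
Qed.

Lemma diffn_affine (R : realType) (n : nat) (f : R -> R) (a b : R) :
  diffn n f -> diffn n (fun x => f (a * x + b)).
Proof.
elim: n f => [|n IH] f; first by move=> _; exact: diffn0.
move=> /diffnS_ex[f' ff' df'].
have D x := is_derive1_affine (ff' (a * x + b)).
by apply/(diffnS n D); apply: diffnM; [exact: diffn_cst|exact: IH].
Qed.

(** Smoothness by coinduction: a class of functions closed under derivation suffices, without a
    formula for iterated derivatives. *)
Lemma smooth_coind (R : realType) (P : (R -> R) -> Prop) :
  (forall f, P f -> exists2 g, (forall x : R, is_derive x 1 f (g x)) & P g) ->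
  forall f, P f -> smooth f.
Proof.
move=> PS f Pf; apply/smooth_diffn => n; elim: n f Pf => [|n IH] f.
  by move=> _; exact: diffn0.
by move=> /PS[g fg Pg]; apply/(diffnS n fg); exact: IH.
Qed.

(* This family, indexed by polynomials, is stable under derivation; the case
   [p = 1] is exp(-1/x) extended by 0. *)
Definition flat (R : realType) (p : {poly R}) (x : R) : R :=
  if 0 < x then p.[x^-1] * expR (- x^-1) else 0.

(** With y = 1/x, the exponential series gives e^y >= y^(n+1) / (n+1)!; the power in excess of n
    leaves the factor [x]. *)
Lemma pow_expRN_le (R : realType) (n : nat) (x : R) : 0 < x ->
  x^-1 ^+ n * expR (- x^-1) <= n.+1`!%:R * x.
Proof.
move=> x0; rewrite expRN ler_pdivrMr ?expR_gt0//.
have y0 : 0 <= x^-1 by rewrite invr_ge0 ltW.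
have h := expR_ge1Dxn n y0.
have f0 : 0 < n.+1`!%:R :> R by rewrite ltr0n fact_gt0.
have : x^-1 ^+ n.+1 / n.+1`!%:R <= expR x^-1.
  by rewrite (le_trans _ h)// lerDr.
rewrite ler_pdivrMr// exprSr => h2.
rewrite -(ler_pM2r (_ : 0 < x^-1)) ?invr_gt0// (le_trans h2)//.
by rewrite mulrAC mulfK ?gt_eqF// mulrC.
Qed.

Lemma flat_le (R : realType) (p : {poly R}) :
  exists C, forall x, `|flat p x| <= C * `|x|.
Proof.
exists (\sum_(i < size p) `|p`_i| * i.+1`!%:R) => x; rewrite /flat.
case: ifPn => x0; last by rewrite normr0 mulr_ge0// sumr_ge0// => i _; rewrite mulr_ge0.
rewrite normrM (ger0_norm (expR_ge0 _)) horner_coef (gtr0_norm x0).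
apply: (@le_trans _ _ ((\sum_(i < size p) `|p`_i * x^-1 ^+ i|) * expR (- x^-1))).
  by rewrite ler_wpM2r ?expR_ge0// ler_norm_sum.
rewrite !mulr_suml; apply: ler_sum => i _.
rewrite normrM normrX -!mulrA ler_wpM2l// ger0_norm ?invr_ge0 ?(ltW x0)//.
exact: pow_expRN_le.
Qed.

(** With y = 1/x, the derivative of p(y) e^(-y) in x is y^2 (p(y) - p'(y)) e^(-y), which is the
    origin of the polynomial. *)
Lemma is_derive_flat (R : realType) (p : {poly R}) (x : R) :
  is_derive x 1 (flat p) (flat ('X ^+ 2 * (p - p^`())) x).
Proof.
have [x0|x0|->] := ltgtP x 0.
- apply: (@near_eq_is_derive _ _ _ (cst 0)); last first.
    by rewrite /flat ltNge ltW//=; exact: is_derive_cst.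
  near=> y; rewrite /flat ltNge ltW//=; near: y; exact: lt_nbhsl.
- apply: (@near_eq_is_derive _ _ _ (fun y : R => p.[y^-1] * expR (- y^-1))).
    near=> y; rewrite /flat ifT//; near: y; exact: lt_nbhsr.
  have xn0 : x != 0 by rewrite gt_eqF.
  have iV : is_derive x 1 (fun y : R => y^-1) (- x ^- 2).
    apply: DeriveDef; first exact: derivableV.
    by rewrite deriveV// derive_id /GRing.scale/= mulr1.
  have ip : is_derive x^-1 1 (horner p) (p^`().[x^-1]).
    by apply/is_derive1P; split; [exact: derivable_horner|rewrite derivE].
  have ie : is_derive x 1 (fun y => expR (- y^-1)) (expR (- x^-1) * x ^- 2).
    apply: (@is_derive1_chain _ (fun y => - y^-1)).
      by by rewrite -[X in is_derive _ _ _ X]opprK; exact: is_derive1N.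
  have ipV := @is_derive1_chain _ (fun y => y^-1) (horner p) _ _ _ iV ip.
  have h := @is_derive1M _ (fun y => p.[y^-1]) _ _ _ _ ipV ie.
  apply: (is_derive_eq h).
  rewrite /flat x0 hornerM hornerXn hornerD hornerN exprVn.
  by ring.
(* At 0 the difference quotient of [flat p] is [flat ('X * p)], and the linear bound for the latter
   makes it tend to 0. *)
- have [C hC] := flat_le ('X * p).
  rewrite {2}/flat ltxx.
  suff h0 : h^-1 *: (flat p (h *: 1 + 0) - flat p 0) @[h --> 0^'] --> (0 : R).
    by apply: DeriveDef; [apply/cvg_ex; exists 0|apply/cvg_lim].
  have eqf (h : R) : h != 0 ->
      h^-1 *: (flat p (h *: 1 + 0) - flat p 0) = flat ('X * p) h.
    move=> h0; rewrite addr0 /GRing.scale/= mulr1 /flat ltxx subr0.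
    by case: ifPn => // _; rewrite ?mulr0// hornerM hornerX mulrA.
  apply/cvgr0Pnorm_lt => e e0; near=> h.
  have h0 : h != 0 by near: h; exact: nbhs_dnbhs_neq.
  rewrite eqf// (le_lt_trans (hC h))//.
  apply: (@le_lt_trans _ _ ((`|C| + 1) * `|h|)).
    by rewrite ler_wpM2r// (le_trans (ler_norm _))// lerDl.
  rewrite -ltr_pdivlMl ?ltr_wpDl// mulrC.
  near: h; apply: dnbhs0_lt; rewrite divr_gt0// ltr_wpDl//.
Unshelve. all: by end_near. Qed.

Lemma smooth_flat (R : realType) (p : {poly R}) : smooth (flat p).
Proof.
apply: (@smooth_coind _ (fun f => exists p, f = flat p)); last by exists p.
move=> _ [q ->]; exists (flat ('X ^+ 2 * (q - q^`()))); last by eexists.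
exact: is_derive_flat.
Qed.

Definition flat1 (R : realType) : R -> R := flat 1.

(** The standard smooth transition from 0 to 1 on [0, 1]; the denominator is positive because x and
    1 - x are never both nonpositive. *)
Definition step (R : realType) (x : R) : R :=
  flat1 x / (flat1 x + flat1 (1 - x)).

Lemma flat1_ge0 (R : realType) (x : R) : 0 <= flat1 x.
Proof. by rewrite /flat1 /flat; case: ifP => // _; rewrite hornerC mul1r expR_ge0. Qed.

Lemma flat1_gt0 (R : realType) (x : R) : 0 < x -> 0 < flat1 x.
Proof. by rewrite /flat1 /flat => ->; rewrite hornerC mul1r expR_gt0. Qed.

Lemma flat1_eq0 (R : realType) (x : R) : x <= 0 -> flat1 x = 0.
Proof. by rewrite /flat1 /flat ltNge => ->. Qed.

Lemma step_den_gt0 (R : realType) (x : R) : 0 < flat1 x + flat1 (1 - x).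
Proof.
have [x0|x0] := ltP 0 x; first by rewrite ltr_wpDr ?flat1_ge0 ?flat1_gt0.
by rewrite ltr_wpDl ?flat1_ge0// flat1_gt0; lra.
Qed.

Lemma smooth_step (R : realType) : smooth (@step R).
Proof.
apply/smooth_diffn => n; have sf := (smooth_diffn (@flat1 R)).1 (@smooth_flat R 1).
apply: diffnM; first exact: sf.
apply: diffnV; first by move=> x; rewrite gt_eqF ?step_den_gt0.
apply: diffnD; first exact: sf.
rewrite (_ : (fun x : R => _) = fun x => flat1 (-1 * x + 1)).
  by apply: diffn_affine; exact: sf.
by apply/funext => x; congr flat1; ring.
Qed.

Lemma step_ge0 (R : realType) (x : R) : 0 <= step x.
Proof. by rewrite divr_ge0 ?flat1_ge0// ltW ?step_den_gt0. Qed.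

Lemma step_le1 (R : realType) (x : R) : step x <= 1.
Proof. by rewrite ler_pdivrMr ?step_den_gt0// mul1r lerDl flat1_ge0. Qed.

Lemma step_eq0 (R : realType) (x : R) : x <= 0 -> step x = 0.
Proof. by move=> x0; rewrite /step flat1_eq0// mul0r. Qed.

Lemma step_eq1 (R : realType) (x : R) : 1 <= x -> step x = 1.
Proof.
move=> x1; rewrite /step (@flat1_eq0 _ (1 - x)) ?subr_le0// addr0 divff//.
by rewrite gt_eqF// flat1_gt0// (lt_le_trans ltr01).
Qed.

Lemma derive1_locally_cst (R : realType) (f : R -> R) (x c : R) :
  (\forall y \near x, f y = c) -> derive1 f x = 0.
Proof.
move=> fc; suff /is_derive1P[] : is_derive x 1 f 0 by [].
apply: near_eq_is_derive (is_derive_cst c x 1).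
by apply: filterS fc.
Qed.

Lemma derive1_step_eq0 (R : realType) (x : R) :
  x < 0 \/ 1 < x -> derive1 (@step R) x = 0.
Proof.
case=> x0; [apply: (@derive1_locally_cst _ _ _ 0)|apply: (@derive1_locally_cst _ _ _ 1)].
  by near=> y; rewrite step_eq0// ltW//; near: y; exact: lt_nbhsl.
by near=> y; rewrite step_eq1// ltW//; near: y; exact: lt_nbhsr.
Unshelve. all: by end_near. Qed.

Lemma smooth_derive (R : realType) (f : R -> R) : smooth f -> smooth (derive1 f).
Proof. by move=> sf n x; rewrite -derive1Sn; exact: sf. Qed.

Lemma smooth_is_derive (R : realType) (f : R -> R) (x : R) : smooth f ->
  is_derive x 1 f (derive1 f x).
Proof. by move=> sf; apply/is_derive1P; split => //; exact: (sf 0). Qed.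

Lemma smooth_continuous (R : realType) (f : R -> R) : smooth f -> continuous f.
Proof. by move=> sf x; exact: is_derive1_continuous (smooth_is_derive x sf). Qed.

(** At 0 and 1 the function [step] attains its global minimum and maximum, so the derivative
    vanishes at these endpoints as well. *)
Lemma derive1_step_out (R : realType) (x : R) :
  x <= 0 \/ 1 <= x -> derive1 (@step R) x = 0.
Proof.
have dS (y : R) : derivable (@step R) y 1 by exact: (@smooth_step R 0).
case; rewrite le_eqVlt => /predU1P[x0|x0];
  try by [apply: derive1_step_eq0; left|apply: derive1_step_eq0; right].
- have h := @derive1_at_min R (@step R) (-1) 1 x
    (ltW (lt_trans (ltrN10 R) ltr01)) (fun y _ => dS y).
  suff : is_derive x 1 (@step R) 0 by move=> /is_derive1P[].
  apply: h.
  + by rewrite x0 in_itv/= ltrN10 ltr01.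
  + by move=> t _; rewrite x0 (@step_eq0 _ 0)// step_ge0.
- have h := @derive1_at_max R (@step R) 0 2 x (ler0n _ 2) (fun y _ => dS y).
  suff : is_derive x 1 (@step R) 0 by move=> /is_derive1P[].
  apply: h.
  + rewrite -x0 in_itv/=; apply/andP; split; lra.
  + by move=> t _; rewrite -x0 (@step_eq1 _ 1)// step_le1.
Qed.

(** The derivative is continuous on [0, 1] and vanishes outside. After rescaling, this bound is the
    constant [M] in the kernel bound [M / r]. *)
Lemma derive1_step_bounded (R : realType) :
  exists2 M : R, 0 < M & forall x, `|derive1 (@step R) x| <= M.
Proof.
have cS : continuous (fun x => `|derive1 (@step R) x|).
  by move=> x; apply: continuous_comp;
    [exact/smooth_continuous/smooth_derive/smooth_step|exact: norm_continuous].
have [c _ hc] := @EVT_max R (fun x => `|derive1 (@step R) x|) 0 1 ler01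
  (continuous_subspaceT cS).
exists (`|derive1 (@step R) c| + 1); first by rewrite ltr_wpDl.
move=> x; have [x0|x0] := ltP x 0.
  by rewrite derive1_step_eq0 ?normr0 ?addr_ge0//; left.
have [x1|x1] := ltP 1 x; first by rewrite derive1_step_eq0 ?normr0 ?addr_ge0//; right.
by rewrite (le_trans (hc x _)) ?lerDl// in_itv/= x0.
Qed.

Local Notation mu := (@lebesgue_measure _).
Local Notation "\int_[ a , b ] f" :=
  (Rintegral mu `[a, b] f) (at level 36, a, b at level 10, f at level 36).

(** * Lebesgue points and weak derivatives on an interval *)

(** Segments replace arbitrary compact sets, since almost all integrals below are over segments;
    [locint_locally] recovers the form that Lebesgue differentiation requires. *)
Definition locint (R : realType) (f : R -> R) : Prop :=
  measurable_fun [set: R] f /\ forall a b, mu.-integrable `[a, b] (EFin \o f).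

Lemma locint_continuous (R : realType) (f : R -> R) : continuous f -> locint f.
Proof.
move=> cf; split; first exact: continuous_measurable_fun.
move=> a b; apply: continuous_compact_integrable; first exact: segment_compact.
exact: continuous_subspaceT.
Qed.

Lemma locintM (R : realType) (f k : R -> R) : locint f -> continuous k ->
  locint (fun x => f x * k x).
Proof.
move=> [mf lf] ck; split.
  by apply: measurable_funM => //; exact: continuous_measurable_fun.
move=> a b.
suff : mu.-integrable `[a, b] ((EFin \o f) \* (EFin \o k))%E by [].
apply: integrableMl => //.
- by apply: measurable_funTS; exact: continuous_measurable_fun.
- have ck' : {within `[a, b], continuous k} by exact: continuous_subspaceT.
  have /compact_bounded[M [_ mrt]] := continuous_compact ck' (segment_compact (a:=a) (b:=b)).
  by exists M; split; rewrite ?num_real // => ? ? ? ?; exact: mrt.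
Qed.

Lemma locintD (R : realType) (f g : R -> R) : locint f -> locint g ->
  locint (fun x => f x + g x).
Proof.
move=> [mf lf] [mg lg]; split; first exact: measurable_funD.
move=> a b.
suff : mu.-integrable `[a, b] ((EFin \o f) \+ (EFin \o g))%E by [].
exact: integrableD.
Qed.

Lemma locintN (R : realType) (f : R -> R) : locint f -> locint (fun x => - f x).
Proof.
move=> [mf lf]; split; first exact: measurableT_comp.
move=> a b.
suff : mu.-integrable `[a, b] (-%E \o (EFin \o f)) by [].
exact: integrableN.
Qed.

Lemma locintB (R : realType) (f g : R -> R) : locint f -> locint g ->
  locint (fun x => f x - g x).
Proof. by move=> lf lg; apply: locintD => //; exact: locintN. Qed.

Lemma locint_norm (R : realType) (f : R -> R) : locint f -> locint (fun x => `|f x|).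
Proof.
move=> [mf lf]; split; first exact: measurableT_comp.
by move=> a b; apply: integrable_norm.
Qed.

Lemma locint_cst (R : realType) (c : R) : locint (fun _ : R => c).
Proof. by apply: locint_continuous; exact: cst_continuous. Qed.

Lemma locint_locally (R : realType) (f : R -> R) :
  locint f -> locally_integrable [set: R] f.
Proof.
move=> [mf lf]; split => // [|K _ cK]; first exact: openT.
have [M [_ hM]] := compact_bounded cK.
have KM : K `<=` `[- (`|M| + 1), `|M| + 1].
  move=> x Kx /=; rewrite in_itv/= -ler_norml; apply: (hM (`|M| + 1)) => //.
  by rewrite (le_lt_trans (ler_norm M))// ltrDl.
have /integrableP[_] := lf (- (`|M| + 1)) (`|M| + 1).
apply: le_lt_trans; apply: ge0_subset_integral => //.
- exact: compact_measurable.
- by do 2 apply: measurableT_comp => //; exact: measurable_funTS.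
Qed.

Lemma Rint_FTC (R : realType) (F f : R -> R) (a b : R) : a <= b ->
  (forall x : R, is_derive x 1 F (f x)) -> continuous f ->
  \int_[a, b] f = F b - F a.
Proof.
rewrite le_eqVlt => /predU1P[->|ab] Ff cf.
  by rewrite set_itv1 Rintegral_set1 subrr.
have cF : continuous F by move=> x; exact: is_derive1_continuous (Ff x).
rewrite /Rintegral (continuous_FTC2 ab (continuous_subspaceT cf) _ (F := F))//.
  split; first by move=> x _; have [] := Ff x.
    exact/cvg_at_right_filter/cF.
  exact/cvg_at_left_filter/cF.
by move=> x _; have /is_derive1P[] := Ff x.
Qed.

(** As [k] has mass 1, the error is the integral of [(f x - f p) * k x]. The kernel lives on a ball
    of measure [2 * r] and is at most [M / r], whence [2 * M] times the mean deviation. The ball may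
    stick out of the segment, as it does when [p] is an endpoint. *)
Lemma kernel_le (R : realType) (f k : R -> R) (a b p r M : R) :
  locint f -> continuous k -> 0 < r ->
  (forall x, `|k x| <= M / r) -> (forall x, r <= `|p - x| -> k x = 0) ->
  \int_[a, b] k = 1 ->
  ((`|\int_[a, b] (fun x => f x * k x) - f p|)%:E <= (2 * M)%:E * davg f p r)%E.
Proof.
move=> lf ck r0 kM k0 k1.
have lfp : locint (fun x => (f x - f p)).
  by apply: locintB => //; exact: locint_cst.
have lfk : locint (fun x => (f x - f p) * k x) by apply: locintM.
have M0 : 0 <= M by have := le_trans (normr_ge0 _) (kM p); rewrite pmulr_lge0// invr_gt0.
have -> : \int_[a, b] (fun x => f x * k x) - f p =
          \int_[a, b] (fun x => (f x - f p) * k x).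
  under [RHS]eq_Rintegral do rewrite mulrBl.
  have [_ lk] := locint_continuous ck.
  rewrite RintegralB//; [|exact: (locintM lf ck).2|].
    by rewrite RintegralZl// k1 mulr1.
  exact: (locintM (locint_cst (f p)) ck).2.
rewrite EFin_normr_Rintegral//; last exact: lfk.2.
apply: (le_trans (le_abse_integral _ _ _)) => //.
  by have /integrableP[] := lfk.2 a b.
have mb : measurable (ball p r : set R) by exact: measurable_ball.
have mfp : measurable_fun [set: R] (fun x => `|f x - f p|).
  by apply: measurableT_comp => //; exact: lfp.1.
apply: (@le_trans _ _ (\int[mu]_(x in `[a, b] `&` ball p r) ((M / r)%:E * (`|f x - f p|)%:E)))%E.
  rewrite [leLHS](_ : _ = \int[mu]_(x in `[a, b])
      ((fun x : R => `|((f x - f p) * k x)%:E|) \_ (ball p r)) x)%E; last first.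
    apply: eq_integral => x _; rewrite patchE; case: ifPn => // /negP xb.
    rewrite /= k0 ?mulr0 ?normr0// leNgt; apply/negP => ?; apply: xb.
    by rewrite inE.
  rewrite -integral_mkcondr; apply: ge0_le_integral => //.
  - exact: measurableI.
  - apply: measurableT_comp => //; apply/measurable_EFinP; apply: measurable_funTS.
    exact: lfk.1.
  - apply: measurable_funeM; apply/measurable_EFinP; exact: measurable_funTS.
  - by move=> x _ /=; rewrite -EFinM lee_fin normrM mulrC ler_wpM2r.
have -> : ((2 * M)%:E * davg f p r = \int[mu]_(x in ball p r) ((M / r)%:E * (`|f x - f p|)%:E))%E.
  rewrite ge0_integralZl//; last 2 first.
    by apply/measurable_EFinP; exact: measurable_funTS.
    by rewrite lee_fin divr_ge0// ltW.
  rewrite /davg /iavg (lebesgue_measure_ball _ (ltW r0)) inver mulrn_eq0/= gt_eqF//.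
  rewrite muleA -EFinM; congr (_%:E * _)%E.
  by rewrite -(mulr_natl r) invfM mulrACA divff// mul1r.
apply: ge0_subset_integral => //.
- exact: measurableI.
- by apply: measurable_funeM; apply/measurable_EFinP; exact: measurable_funTS.
- by move=> x _; rewrite -EFinM lee_fin mulr_ge0// divr_ge0// ltW.
Qed.

Lemma kernel_cvg (R : realType) (f : R -> R) (k : R -> R -> R) (a b p M d : R) :
  locint f -> lebesgue_pt f p -> 0 < d ->
  (forall r, 0 < r < d -> [/\ continuous (k r), forall x, `|k r x| <= M / r,
     forall x, r <= `|p - x| -> k r x = 0 & \int_[a, b] (k r) = 1]) ->
  \int_[a, b] (fun x => f x * k r x) @[r --> 0^'+] --> f p.
Proof.
move=> lf fp d0 hk; apply/cvgrPdist_lt => e e0.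
have M1 : 0 < (2 * `|M| + 1) by rewrite ltr_wpDl// mulr_ge0.
have := fp; move=> /fine_cvgP[fin /cvgrPdist_lt /(_ (e / (2 * `|M| + 1)))].
rewrite divr_gt0// => /(_ isT) H; near=> r.
have rd : 0 < r < d.
  by apply/andP; split; near: r; [exact: nbhs_right_gt|exact: nbhs_right_lt].
have [ck kM k0 k1] := hk r rd; have /andP[r0 _] := rd.
have hle := kernel_le lf ck r0 kM k0 k1.
have davgf : davg f p r \is a fin_num by near: r.
have : `|0 - fine (davg f p r)| < e / (2 * `|M| + 1) by near: r.
rewrite sub0r normrN ger0_norm ?fine_ge0 ?davg_ge0// ltr_pdivlMr// => he.
rewrite distrC -lte_fin (le_lt_trans hle)//.
rewrite -(fineK davgf) -EFinM lte_fin (le_lt_trans _ he)// mulrC.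
rewrite ler_wpM2l ?fine_ge0 ?davg_ge0//.
by rewrite (le_trans (ler_norm _))// normrM ger0_norm// lerDl.
Unshelve. all: by end_near. Qed.

Lemma locintZ (R : realType) (c : R) (f : R -> R) : locint f ->
  locint (fun x => c * f x).
Proof.
move=> lf; rewrite (_ : (fun x => _) = fun x => f x * c).
  by apply: locintM => //; exact: cst_continuous.
by apply/funext => x; rewrite mulrC.
Qed.

Lemma Rint_chasles (R : realType) (f : R -> R) (a c b : R) : locint f ->
  a <= c <= b -> \int_[a, b] f = \int_[a, c] f + \int_[c, b] f.
Proof.
move=> [_ lf] /andP[ac cb].
have := @Rintegral_itvB R f (BLeft a) (BRight b) c (lf a b).
rewrite !bnd_simp => /(_ ac cb) /eqP; rewrite subr_eq => /eqP ->.
rewrite addrC; congr (_ + _); rewrite Rintegral_itv_obnd_cbnd//.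
by apply: integrableS (lf c b) => //; apply: subset_itvr; rewrite bnd_simp.
Qed.

Lemma Rint_point (R : realType) (f : R -> R) (a : R) : \int_[a, a] f = 0.
Proof. by rewrite set_itv1 Rintegral_set1. Qed.

Lemma Rint_cvg_left (R : realType) (f : R -> R) (a b : R) : locint f -> a < b ->
  \int_[a, a + r] f @[r --> 0^'+] --> (0 : R).
Proof.
move=> [_ lf] ab.
have := @parameterized_integral_cvg_left R a b f ab (lf a b).
rewrite /parameterized_integral => h.
have h2 : (a + r : R) @[r --> 0^'+] --> a.
  apply: cvg_at_right_filter; rewrite -[X in _ --> X]addr0.
  by apply: cvgD; [exact: cvg_cst|exact: cvg_id].
exact: (cvg_comp _ _ h2 h).
Qed.

Lemma Rint_cvg_right (R : realType) (f : R -> R) (a b : R) : locint f -> a < b ->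
  \int_[b - r, b] f @[r --> 0^'+] --> (0 : R).
Proof.
move=> lf ab.
have h := @parameterized_integral_cvg_at_left R a b f ab (lf.2 a b).
have h2 : (b - r : R) @[r --> 0^'+] --> b^'-.
  move=> A [e /= e0 eA]; have : \forall r \near 0^'+, A (b - r).
    near=> r; apply: eA => /=.
      rewrite opprB addrC subrK ger0_norm.
        by near: r; exact: nbhs_right_lt.
      by near: r; exact: nbhs_right_ge.
    by rewrite ltrBlDr ltrDl; near: r; exact: nbhs_right_gt.
  by [].
have h3 := cvg_comp _ _ h2 h.
rewrite -[X in _ --> X](subrr (\int_[a, b] f)).
have h4 := cvgB (cvg_cst (\int_[a, b] f)) h3.
apply: cvg_trans (h4 _ _).
apply: near_eq_cvg; near=> r.
rewrite (@Rint_chasles _ f a (b - r) b)//; last first.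
  rewrite lerBrDr -lerBrDl gerBl; apply/andP; split; near: r.
    by apply: nbhs_right_le; rewrite subr_gt0.
  exact: nbhs_right_ge.
by rewrite !fctE /= /parameterized_integral addrC addKr.
Unshelve. all: by end_near. Qed.

(** * Smooth trapezoids and the increment formula *)

Definition ramp (R : realType) (r c x : R) : R := step (r^-1 * x + c).

(** The smooth trapezoid: for small positive [r], the first ramp rises from 0 to 1 on [a, a + r] and
    the second, on [b - r, b], brings the value back to 0. *)
Definition plateau (R : realType) (a b r x : R) : R :=
  ramp r (- (r^-1 * a)) x - ramp r (1 - r^-1 * b) x.

(** The slope of [ramp]: for [0 < r], an approximate identity with mass 1 on an interval of length
    [r]. *)
Definition dramp (R : realType) (r c x : R) : R :=
  r^-1 * derive1 (@step R) (r^-1 * x + c).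

Lemma is_derive_ramp (R : realType) (r c x : R) :
  is_derive x 1 (ramp r c) (dramp r c x).
Proof. exact/is_derive1_affine/smooth_is_derive/smooth_step. Qed.

Lemma is_derive_plateau (R : realType) (a b r x : R) :
  is_derive x 1 (plateau a b r) (dramp r (- (r^-1 * a)) x - dramp r (1 - r^-1 * b) x).
Proof. by apply: is_derive1B; exact: is_derive_ramp. Qed.

Lemma smooth_plateau (R : realType) (a b r : R) : smooth (plateau a b r).
Proof.
apply/smooth_diffn => n.
have sr c : diffn n (ramp r c).
  by apply: diffn_affine; exact: (smooth_diffn _).1 (smooth_step (R := R)) n.
apply: diffnD => //.
rewrite (_ : (fun x => _) = fun x => -1 * ramp r (1 - r^-1 * b) x).
  by apply: diffnM => //; exact: diffn_cst.
by apply/funext => x; rewrite mulN1r.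
Qed.

Lemma continuous_dramp (R : realType) (r c : R) : continuous (dramp r c).
Proof.
move=> x; apply: cvgM; first exact: cvg_cst.
apply: (@continuous_comp _ _ _ (fun y : R => r^-1 * y + c) (derive1 (@step R))).
  by apply: cvgD; [apply: cvgM; [exact: cvg_cst|exact: cvg_id]|exact: cvg_cst].
exact/smooth_continuous/smooth_derive/smooth_step.
Qed.

Lemma ramp_out (R : realType) (r c x : R) : 0 < r ->
  (x <= - (r * c) -> ramp r c x = 0) /\ (r - r * c <= x -> ramp r c x = 1).
Proof.
move=> r0; split => hx; rewrite /ramp; [apply: step_eq0|apply: step_eq1].
  by rewrite -lerBrDr sub0r ler_pdivrMl// mulrN.
by rewrite -lerBlDr ler_pdivlMl// mulrBr mulr1.
Qed.

Lemma plateau_out (R : realType) (a b r x : R) : 0 < r -> r <= b - a ->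
  (x <= a -> plateau a b r x = 0) /\ (b <= x -> plateau a b r x = 0).
Proof.
move=> r0 rab; have rn0 : r != 0 by rewrite gt_eqF.
have [ha1 ha2] := ramp_out (- (r^-1 * a)) x r0.
have [hb1 hb2] := ramp_out (1 - r^-1 * b) x r0.
rewrite mulrN mulVKf// opprK in ha1 ha2.
rewrite mulrBr mulr1 mulVKf// opprB in hb1 hb2.
by split=> hx; rewrite /plateau; [rewrite ha1 ?hb1|rewrite ha2 ?hb2]; lra.
Qed.

Lemma plateau_mid (R : realType) (a b r x : R) : 0 < r ->
  a + r <= x <= b - r -> plateau a b r x = 1.
Proof.
move=> r0 /andP[ax xb]; have rn0 : r != 0 by rewrite gt_eqF.
have [_ ha2] := ramp_out (- (r^-1 * a)) x r0.
have [hb1 _] := ramp_out (1 - r^-1 * b) x r0.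
rewrite mulrN mulVKf// opprK in ha2.
rewrite mulrBr mulr1 mulVKf// opprB in hb1.
by rewrite /plateau ha2 ?hb1; lra.
Qed.

Lemma plateau_norm1B (R : realType) (a b r x : R) : `|1 - plateau a b r x| <= 2.
Proof.
have := step_ge0 (r^-1 * x - r^-1 * a); have := step_le1 (r^-1 * x - r^-1 * a).
have := step_ge0 (r^-1 * x + (1 - r^-1 * b)); have := step_le1 (r^-1 * x + (1 - r^-1 * b)).
by rewrite /plateau /ramp ler_norml => *; apply/andP; split; lra.
Qed.

(** The trapezoid differs from 1 only on two end intervals of length [r], over which the integral of
    [|g|] tends to 0. *)
Lemma plateau_cvg (R : realType) (g : R -> R) (a b : R) : locint g -> a < b ->
  \int_[a, b] (fun x => g x * plateau a b r x) @[r --> 0^'+] --> \int_[a, b] g.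
Proof.
move=> lg ab; have lng := locint_norm lg.
have hl := Rint_cvg_left lng ab; have hr := Rint_cvg_right lng ab.
apply/cvgrPdist_lt => e e0.
(* Two ends, each with the crude factor 2 from [plateau_norm1B]. *)
have e4 : 0 < e / 4 by rewrite divr_gt0.
have key (A B C D : R) : A < e / 4 -> B < e / 4 -> C <= 2 * A -> D <= 2 * B ->
  C + (0 + D) < e by clear; lra.
move/cvgrPdist_lt : hl => /(_ _ e4) hl; move/cvgrPdist_lt : hr => /(_ _ e4) hr.
near=> r.
have r0 : 0 < r by near: r; exact: nbhs_right_gt.
have rab : r < (b - a) / 2 by near: r; apply: nbhs_right_lt; rewrite divr_gt0// subr_gt0.
have cp : continuous (plateau a b r) by exact/smooth_continuous/smooth_plateau.
have lgp : locint (fun x => g x * plateau a b r x) by exact: locintM.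
have lgd : locint (fun x => g x - g x * plateau a b r x) by exact: locintB.
have lnd := locint_norm lgd.
rewrite -RintegralB//; [|exact: lg.2|exact: lgp.2].
apply: (le_lt_trans (le_normr_Rintegral _ (lgd.2 a b))) => //.
rewrite (@Rint_chasles _ _ a (a + r) b)//; last by apply/andP; split; lra.
rewrite (@Rint_chasles _ _ (a + r) (b - r) b)//; last by apply/andP; split; lra.
have -> : \int_[a + r, b - r] (fun t => `|g t - g t * plateau a b r t|) = 0.
  rewrite [LHS](_ : _ = \int_[a + r, b - r] (fun=> 0)); last first.
    apply: eq_Rintegral => x; rewrite inE/= in_itv/= => hx.
    by rewrite plateau_mid// mulr1 subrr normr0.
  by rewrite /Rintegral integral0.
have hb c d : \int_[c, d] (fun t => `|g t - g t * plateau a b r t|) <=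
    2 * \int_[c, d] (fun t => `|g t|).
  rewrite -RintegralZl//; last exact: lng.2.
  apply: le_Rintegral => //; first exact: lnd.2.
    exact: (locintZ 2 lng).2.
  move=> x _; rewrite -{1}(mulr1 (g x)) -mulrBr normrM mulrC.
  by rewrite ler_wpM2r// plateau_norm1B.
have h1 : `|0 - \int_[a, a + r] (fun t => `|g t|)| < e / 4 by near: r.
have h2 : `|0 - \int_[b - r, b] (fun t => `|g t|)| < e / 4 by near: r.
rewrite sub0r normrN ger0_norm in h1; last exact: Rintegral_ge0.
rewrite sub0r normrN ger0_norm in h2; last exact: Rintegral_ge0.
exact: key h1 h2 (hb a (a + r)) (hb (b - r) b).
Unshelve. all: by end_near. Qed.

(** The slope has mass 1 because the ramp climbs from 0 to 1 across the segment; the last condition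
    on [c] keeps its support within distance [r] of [p]. *)
Lemma dramp_cvg (R : realType) (f : R -> R) (a b p : R) (c : R -> R) :
  locint f -> lebesgue_pt f p -> a < b ->
  (forall r, 0 < r < b - a -> [/\ ramp r (c r) a = 0, ramp r (c r) b = 1 &
     forall x, r <= `|p - x| -> x <= - (r * c r) \/ r - r * c r <= x]) ->
  \int_[a, b] (fun x => f x * dramp r (c r) x) @[r --> 0^'+] --> f p.
Proof.
move=> lf fp ab hc; have [M M0 hM] := derive1_step_bounded R.
apply: (@kernel_cvg _ _ (fun r => dramp r (c r)) a b p M (b - a)) => //.
  by rewrite subr_gt0.
move=> r /[dup] rab /andP[r0 _]; have [ra rb out] := hc r rab; split.
- exact: continuous_dramp.
- move=> x; rewrite /dramp normrM gtr0_norm ?invr_gt0// mulrC.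
  by rewrite ler_wpM2r// invr_ge0 ltW.
- move=> x /out hx; rewrite /dramp derive1_step_out ?mulr0//.
  case: hx => hx; [left|right].
    by rewrite -lerBrDr sub0r ler_pdivrMl// mulrN.
  by rewrite -lerBlDr ler_pdivlMl// mulrBr mulr1.
- rewrite (Rint_FTC (ltW ab) (is_derive_ramp r (c r)) (@continuous_dramp _ r (c r))).
  by rewrite ra rb subr0.
Qed.

(** The derivative of a trapezoid is an approximate identity at [a] minus one at [b]. As [r] tends
    to 0, testing with it gives [f a - f b] on the left and minus the integral of [g] on the
    right. *)
Lemma weak_derivative_increment (R : realType) (f g : R -> R) (a b : R) :
  locint f -> locint g -> a < b -> lebesgue_pt f a -> lebesgue_pt f b ->
  (forall phi, smooth phi -> (forall x, x <= a \/ b <= x -> phi x = 0) ->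
    \int_[a, b] (fun x => f x * derive1 phi x) =
    - \int_[a, b] (fun x => g x * phi x)) ->
  f b - f a = \int_[a, b] g.
Proof.
move=> lf lg ab fa fb hw.
have ba : 0 < b - a by rewrite subr_gt0.
have ha : \int_[a, b] (fun x => f x * dramp r (- (r^-1 * a)) x) @[r --> 0^'+] --> f a.
  apply: (@dramp_cvg _ _ _ _ _ (fun r => - (r^-1 * a))) => // r /andP[r0 rab].
  have rn0 : r != 0 by rewrite gt_eqF.
  have E : r * - (r^-1 * a) = - a by rewrite mulrN mulVKf.
  split; last 1 first.
  - move=> x; rewrite E opprK => hx; have [xa|xa] := leP x a; first by left.
    by right; move: hx; rewrite distrC gtr0_norm ?subr_gt0//; lra.
  - by apply: (ramp_out _ _ r0).1; rewrite E; lra.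
  - by apply: (ramp_out _ _ r0).2; rewrite E; lra.
have hb : \int_[a, b] (fun x => f x * dramp r (1 - r^-1 * b) x) @[r --> 0^'+] --> f b.
  apply: (@dramp_cvg _ _ _ _ _ (fun r => 1 - r^-1 * b)) => // r /andP[r0 rab].
  have rn0 : r != 0 by rewrite gt_eqF.
  have E : r * (1 - r^-1 * b) = r - b by rewrite mulrBr mulr1 mulVKf.
  split; last 1 first.
  - move=> x; rewrite E => hx; have [xa|xa] := leP b x; first by right; lra.
    by left; move: hx; rewrite gtr0_norm ?subr_gt0//; lra.
  - by apply: (ramp_out _ _ r0).1; rewrite E; lra.
  - by apply: (ramp_out _ _ r0).2; rewrite E; lra.
have hB := cvgB ha hb.
have hg := cvgN (plateau_cvg lg ab).
suff E : f a - f b = - \int_[a, b] g by rewrite -opprB E opprK.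
apply: (norm_cvg_unique (hB _)) => /=; apply: cvg_trans (hg _); apply: near_eq_cvg; near=> r.
have r0 : 0 < r by near: r; exact: nbhs_right_gt.
have rab : r < b - a by near: r; exact: nbhs_right_lt.
have cd c := @continuous_dramp R r c.
have := hw (plateau a b r) (@smooth_plateau R a b r).
rewrite (is_derive1_ext (is_derive_plateau a b r)) => E.
rewrite !fctE /= -E; last first.
  by move=> x [] hx; have [h1 h2] := plateau_out x r0 (ltW rab); auto.
rewrite -RintegralB//; [|exact: (locintM lf _).2..].
by apply: eq_Rintegral => x _; rewrite mulrBr.
Unshelve. all: by end_near. Qed.

(** * Periodization *)

(** The 1-periodic function equal to [phi] on [a, a + 1); the origin [a] is free so that a given
    support can be placed strictly inside a period. *)
Definition periodize (R : realType) (a : R) (phi : R -> R) (x : R) : R :=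
  phi (x - (Num.floor (x - a))%:~R).

Lemma floor_unique (R : realType) (x : R) (n : int) :
  n%:~R <= x < n%:~R + 1 -> Num.floor x = n.
Proof. by move=> h; apply: floor_def; rewrite rmorphD. Qed.

Lemma floor_bounds (R : realType) (x : R) :
  (Num.floor x)%:~R <= x < (Num.floor x)%:~R + 1.
Proof. by have := floor_itv x; rewrite rmorphD. Qed.

Lemma periodizeE (R : realType) (a : R) (phi : R -> R) (x : R) (n : int) :
  n%:~R + a <= x < n%:~R + a + 1 -> periodize a phi x = phi (x - n%:~R).
Proof.
move=> /andP[h1 h2]; rewrite /periodize (@floor_unique _ _ n)//.
by apply/andP; split; lra.
Qed.

Lemma periodize_id (R : realType) (a : R) (phi : R -> R) (x : R) :
  a <= x < a + 1 -> periodize a phi x = phi x.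
Proof.
by move=> h; rewrite (@periodizeE _ _ _ _ 0) ?subr0// !add0r.
Qed.

Lemma periodic_periodize (R : realType) (a : R) (phi : R -> R) :
  periodic (periodize a phi) 1.
Proof.
move=> x; have /andP[h1 h2] := floor_bounds (x - a).
rewrite (@periodizeE _ _ _ (x + 1) (Num.floor (x - a) + 1)); last first.
  by rewrite rmorphD /=; apply/andP; split; lra.
by rewrite rmorphD /= /periodize; congr phi; lra.
Qed.

(** Since the support stays away from both ends of the period, the periodization is locally 0 at the
    seams and locally a translate of [phi] elsewhere. *)
Lemma is_derive_periodize (R : realType) (a c d x : R) (phi dphi : R -> R) :
  (forall x : R, is_derive x 1 phi (dphi x)) ->
  (forall x, x < c \/ d < x -> phi x = 0) -> a < c -> d < a + 1 ->
  is_derive x 1 (periodize a phi) (periodize a dphi x).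
Proof.
move=> dp out ac da; have /andP[h1 h2] := floor_bounds (x - a).
set n := Num.floor (x - a) in h1 h2.
have -> : periodize a dphi x = dphi (x - n%:~R) by [].
(* The seam: [x] is an integer translate of [a], and the points on its two sides belong to periods
   [n - 1] and [n]. *)
move: h1; rewrite le_eqVlt => /predU1P[h1|h1].
  have xn : x - n%:~R = a by rewrite h1 opprB addrC subrK.
  rewrite xn.
  have -> : dphi a = 0.
    have /is_derive1P[_ <-] := dp a; apply: (@derive1_locally_cst _ _ _ 0).
    by near=> y; apply: out; left; near: y; exact: lt_nbhsl.
  apply: near_eq_is_derive (is_derive_cst (0 : R) x 1).
  near=> y; apply/esym; have [xy|yx] := leP x y.
    rewrite (@periodizeE _ _ _ _ n); last first.
      apply/andP; split; first lra.
      by near: y; apply: lt_nbhsl; lra.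
    by apply: out; left; rewrite ltrBlDr; near: y; apply: lt_nbhsl; lra.
  rewrite (@periodizeE _ _ _ _ (n - 1)); last first.
    rewrite rmorphB /=; apply/andP; split; last lra.
    by apply/ltW; near: y; apply: lt_nbhsr; lra.
  apply: out; right; rewrite rmorphB/= ltrBrDr; near: y; apply: lt_nbhsr; lra.
apply: (@near_eq_is_derive _ _ _ (fun y : R => phi (1 * y - n%:~R))).
  near=> y; rewrite (@periodizeE _ _ _ _ n) ?mul1r//.
  apply/andP; split; last by near: y; apply: lt_nbhsl; lra.
  by apply/ltW; near: y; apply: lt_nbhsr; lra.
rewrite -[X in is_derive _ _ _ X]mul1r; apply: is_derive1_affine.
by rewrite mul1r.
Unshelve. all: by end_near. Qed.

Lemma derive1_out (R : realType) (c d : R) (phi : R -> R) :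
  (forall x, x < c \/ d < x -> phi x = 0) ->
  forall x, x < c \/ d < x -> derive1 phi x = 0.
Proof.
move=> out x hx; apply: (@derive1_locally_cst _ _ _ 0); case: hx => hx.
  by near=> y; apply: out; left; near: y; exact: lt_nbhsl.
by near=> y; apply: out; right; near: y; exact: lt_nbhsr.
Unshelve. all: by end_near. Qed.

Lemma derive1n_out (R : realType) (c d : R) (phi : R -> R) (n : nat) :
  (forall x, x < c \/ d < x -> phi x = 0) ->
  forall x, x < c \/ d < x -> derive1n n phi x = 0.
Proof. by elim: n phi => // n IH phi out; apply: derive1_out; exact: IH. Qed.

Lemma derive1n_periodize (R : realType) (a c d : R) (phi : R -> R) (n : nat) :
  smooth phi -> (forall x, x < c \/ d < x -> phi x = 0) -> a < c -> d < a + 1 ->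
  derive1n n (periodize a phi) = periodize a (derive1n n phi).
Proof.
move=> sp out ac da; elim: n => // n IH; rewrite derive1nS IH derive1nS.
apply: is_derive1_ext => x; apply: is_derive_periodize => //; last first.
- exact: da.
- exact: ac.
- exact: derive1n_out.
- by move=> y; apply/is_derive1P; split => //; exact: sp.
Qed.

Lemma smooth_periodize (R : realType) (a c d : R) (phi : R -> R) :
  smooth phi -> (forall x, x < c \/ d < x -> phi x = 0) -> a < c -> d < a + 1 ->
  smooth (periodize a phi).
Proof.
move=> sp out ac da n x; rewrite (derive1n_periodize n sp out ac da).
have h : is_derive x 1 (periodize a (derive1n n phi)) (periodize a (derive1n n.+1 phi) x).
  apply: is_derive_periodize; last exact: da; last exact: ac; last exact: derive1n_out.
  by move=> y; apply/is_derive1P; split => //; exact: sp.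
by have /is_derive1P[] := h.
Qed.

(** * Translations and periods in Lebesgue integrals *)

Section integral_shift.
Context {R : realType}.

Lemma lebesgue_measure_shift (c : R) (A : set R) : measurable A ->
  lebesgue_measure A =
  pushforward (@lebesgue_measure R) (fun x : R => x + c : measurableTypeR R) A.
Proof.
move=> mA; have mf : measurable_fun [set: R] (fun x : R => x + c).
  by apply: measurable_funD.
apply: lebesgue_measure_unique => //= _ [[a b]] _ <-.
rewrite /pushforward (_ : _ @^-1` _ = `]a - c, b - c]%classic); last first.
  by apply/seteqP; split => x /=; rewrite !in_itv/= ltrBlDr lerBrDr.
rewrite !lebesgue_measure_itv/= !lte_fin ltrBlDr subrK.
by rewrite -!EFinD opprB addrA subrK.
Qed.

Lemma ge0_integral_shift (c : R) (D : set R) (H : R -> \bar R) :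
  measurable D -> measurable_fun [set: R] H -> (forall x, 0 <= H x)%E ->
  (\int[lebesgue_measure]_(y in D) H y =
   \int[lebesgue_measure]_(x in (fun x => (x + c)%R) @^-1` D) H (x + c)%R)%E.
Proof.
move=> mD mH H0; have mf : measurable_fun [set: R] (fun x : R => (x + c)%R).
  by apply: measurable_funD.
rewrite (@eq_measure_integral _ _ _ _
  (pushforward (@lebesgue_measure R) (fun x : R => (x + c)%R : measurableTypeR R))).
  rewrite ge0_integral_pushforward//; exact: measurable_funTS.
by move=> A mA _; exact: lebesgue_measure_shift.
Qed.

Lemma periodic_int (T : Type) (H : R -> T) (n : int) (x : R) :
  (forall x, H (x + 1) = H x) -> H (x + n%:~R) = H x.
Proof.
move=> pH; have hn (m : nat) y : H (y + m%:R) = H y.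
  by elim: m y => [|m IH] y; rewrite ?addr0// -natr1 addrA pH.
case: n => m; first exact: hn.
by rewrite NegzE rmorphN /= -[in RHS](subrK (m.+1%:R) x) hn.
Qed.

(** With n the floor of [a], the intervals [n, n + 1) and [a, a + 1) share [a, n + 1), and the
    remaining pieces differ by a translation by 1. *)
Lemma ge0_integral_periodic (H : R -> \bar R) (a : R) :
  measurable_fun [set: R] H -> (forall x, 0 <= H x)%E ->
  (forall x, H (x + 1) = H x) ->
  (\int[lebesgue_measure]_(x in `[0%R, 1%R[) H x =
   \int[lebesgue_measure]_(x in `[a, (a + 1)%R[) H x)%E.
Proof.
move=> mH H0 pH; have /andP[na an] := floor_bounds a.
set n := Num.floor a in na an.
have shift (m : int) b d : (\int[lebesgue_measure]_(x in `[(b + m%:~R)%R, (d + m%:~R)%R[) H x =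
    \int[lebesgue_measure]_(x in `[b, d[) H x)%E.
  rewrite (@ge0_integral_shift m%:~R)//.
  rewrite (_ : _ @^-1` _ = `[b, d[%classic); last first.
    by apply/seteqP; split => x /=; rewrite !in_itv/= lerD2r ltrD2r.
  by apply: eq_integral => x _; rewrite periodic_int.
rewrite -(shift n) add0r (@itv_bndbnd_setU _ _ _ (BLeft a)) ?bnd_simp//; last first.
  by rewrite addrC ltW.
rewrite (@itv_bndbnd_setU _ _ (BLeft a) (BLeft (1 + n%:~R)) (BLeft (a + 1)))
  ?bnd_simp//; last 2 first.
- by rewrite addrC ltW.
- by rewrite addrC lerD2r.
have dis (x y z : R) : [disjoint `[x, y[%classic & `[y, z[%classic].
  apply/disj_setPS => w /= []; rewrite !in_itv/= => /andP[_ wy] /andP[yw _].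
  by move: wy; rewrite ltNge yw.
rewrite !ge0_integral_setU//; try exact: measurable_funTS.
rewrite addeC; congr (_ + _)%E.
by rewrite -(shift 1) /= addrC [(_ + 1)%R]addrC.
Qed.

End integral_shift.

(** * Square-integrable functions on the line and on the circle *)

Lemma integral_mrestr (R : realType) (D : set R) (mD : measurable (D : set (measurableTypeR R)))
  (H : R -> \bar R) : measurable_fun [set: R] H ->
  (\int[mrestr (@lebesgue_measure R) mD]_x H x = \int[@lebesgue_measure R]_(x in D) H x)%E.
Proof.
move=> mH; rewrite -(setUv D) integral_setU//; last 3 first.
- exact: measurableC.
- exact: measurable_funTS.
- by apply/disj_setPS => x [].
rewrite (@eq_measure_integral _ (measurableTypeR R) R D (@lebesgue_measure R)); last first.
  by move=> A mA AD; rewrite /= /mrestr setIidl.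
rewrite (@eq_measure_integral _ (measurableTypeR R) R (~` D) mzero) ?integral_measure_zero ?adde0//.
by move=> A mA AD; rewrite /= /mrestr /mzero (_ : A `&` D = set0) ?measure0//;
  apply/seteqP; split => x // [/AD].
Qed.

(** This brings both spaces to one form, an integral over a unit interval with arbitrary origin.
    Signed periodic functions are split into positive and negative parts. *)
Lemma space_integral (R : realType) (X : spatial_domain) (a : R) (H : R -> \bar R) :
  measurable_fun [set: R] H ->
  match X with
  | Line => forall x, ~ (a <= x < a + 1) -> H x = 0%E
  | Circle => forall x, H (x + 1) = H x
  end ->
  (\int[space_measure R X]_x H x = \int[@lebesgue_measure R]_(x in `[a, (a + 1)%R[) H x)%E.
Proof.
case: X => mH /= hH.
  rewrite [RHS]integral_mkcond; apply: eq_integral => x _.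
  rewrite patchE; case: ifPn => // /negP; rewrite inE/= in_itv/= => xa.
  exact: hH.
rewrite integral_mrestr// integralE [RHS]integralE.
rewrite (@ge0_integral_periodic R (H^\+)%E a)//; last 2 first.
- exact: measurable_funepos.
- by move=> x; rewrite !funeposE hH.
rewrite (@ge0_integral_periodic R (H^\-)%E a)//; first exact: measurable_funeneg.
by move=> x; rewrite !funenegE hH.
Qed.

Definition norm2 (R : realType) (X : spatial_domain) (h : R -> R) : R :=
  fine ('N[space_measure R X]_2%:E [EFin \o h])%E.

Lemma L2_measurable (R : realType) (X : spatial_domain) (h : R -> R) :
  L2 X h -> measurable_fun [set: R] h.
Proof. by move=> [_ /sub_Lfun_mfun]; rewrite inE. Qed.

Lemma norm2_ge0 (R : realType) (X : spatial_domain) (h : R -> R) : 0 <= norm2 X h.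
Proof. by rewrite fine_ge0// Lnorm_ge0. Qed.

Lemma sqr_norm2 (R : realType) (X : spatial_domain) (h : R -> R) : L2 X h ->
  ((norm2 X h ^+ 2)%:E = \int[space_measure R X]_x (h x ^+ 2)%:E)%E.
Proof.
move=> [_ hL]; have fin : ('N[space_measure R X]_2%:E [EFin \o h] \is a fin_num)%E.
  rewrite ge0_fin_numE ?Lnorm_ge0//.
  by have /sub_Lfun_finLfun := hL; rewrite inE.
have := poweR_Lnorm (space_measure R X) (EFin \o h) (_ : (2 : R) != 0).
rewrite pnatr_eq0 => /(_ isT).
rewrite -(fineK fin) poweR_EFin -/(norm2 X h) powR_mulrn ?norm2_ge0// => ->.
by apply: eq_integral => x _; rewrite /= powR_mulrn// real_normK// num_real.
Qed.

(** A unit interval is a full period of the circle and a subset of the line, hence the common scale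
    of the estimates. *)
Lemma L2_itv1_le (R : realType) (X : spatial_domain) (h : R -> R) (a : R) : L2 X h ->
  (\int[@lebesgue_measure R]_(x in `[a, (a + 1)%R[) (h x ^+ 2)%:E <= (norm2 X h ^+ 2)%:E)%E.
Proof.
move=> Lh; rewrite sqr_norm2//.
have mh2 : measurable_fun [set: R] (fun x => (h x ^+ 2)%:E).
  by apply/measurable_EFinP/measurable_funX; exact: L2_measurable Lh.
case: X Lh => Lh; last first.
  by rewrite (@space_integral _ _ a)// => x; have [->] := Lh.
by apply: ge0_subset_integral => // x _; rewrite lee_fin sqr_ge0.
Qed.

Lemma L2_integrable_itv1 (R : realType) (X : spatial_domain) (h : R -> R) (a : R) :
  L2 X h -> mu.-integrable `[a, a + 1[ (EFin \o h).
Proof.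
move=> Lh; have mh := L2_measurable Lh; apply/integrableP; split.
  by apply/measurable_EFinP; exact: measurable_funTS.
apply: (@le_lt_trans _ _ (\int[mu]_(x in `[a, (a + 1)%R[) (1 + (h x ^+ 2)%:E)))%E.
  apply: ge0_le_integral => //.
  - by apply/measurable_EFinP/measurable_funTS; exact: measurableT_comp.
  - apply: emeasurable_funD => //; apply/measurable_EFinP/measurable_funTS.
    exact: measurable_funX.
  - move=> x _; rewrite /= -EFinD lee_fin -[h x ^+ 2]real_normK ?num_real//.
    by have := sqr_ge0 (`|h x| - 1); rewrite !expr2; nra.
rewrite ge0_integralD//; last 2 first.
- by move=> x _; rewrite lee_fin sqr_ge0.
- by apply/measurable_EFinP/measurable_funTS; exact: measurable_funX.
rewrite lte_add_pinfty//; last exact: (le_lt_trans (L2_itv1_le a Lh) (ltry _)).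
rewrite integral_cst//= mul1e lebesgue_measure_itv/= lte_fin ltrDl ltr01.
by rewrite -EFinD ltry.
Qed.

Lemma L2_locint (R : realType) (X : spatial_domain) (h : R -> R) : L2 X h -> locint h.
Proof.
move=> Lh; split; first exact: L2_measurable Lh.
move=> a b; have hn (n : nat) : mu.-integrable `[a, a + n%:R[ (EFin \o h).
  elim: n => [|n IH]; first by rewrite addr0 set_itvxx; exact: integrable_set0.
  rewrite (@itv_bndbnd_setU _ _ _ (BLeft (a + n%:R))) ?bnd_simp//.
  - have mnh : measurable_fun [set: R] (fun x => (`|h x|)%:E).
      by apply/measurable_EFinP/measurableT_comp => //; exact: L2_measurable Lh.
    apply/integrableP; split.
      by apply/measurable_EFinP/measurable_funTS; exact: L2_measurable Lh.
    rewrite ge0_integral_setU//; last 2 first.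
      exact: measurable_funTS.
      apply/disj_setPS => x /= []; rewrite !in_itv/= => /andP[_ xy] /andP[yx _].
      by move: xy; rewrite ltNge yx.
    have /integrableP[_ h1] := IH.
    have /integrableP[_ h2] := L2_integrable_itv1 (a + n%:R) Lh.
    by rewrite -natr1 (addrA a); exact: (lte_add_pinfty h1 h2).
  - by rewrite lerDl.
  - by rewrite lerD2l ler_nat.
have [n hn2] : exists n : nat, b - a < n%:R.
  by exists (Num.truncn (b - a)).+1; rewrite truncnS_gt.
apply: integrableS (hn n) => // x /=; rewrite !in_itv/= => /andP[-> xb] /=.
by rewrite (le_lt_trans xb)// -ltrBlDl.
Qed.

(** Young's inequality |h| <= e/2 + h^2/(2e), integrated. The parameter [e] stays free: near the
    norm it yields Cauchy-Schwarz, and small it yields decay. *)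
Lemma Rint_norm_young (R : realType) (X : spatial_domain) (h : R -> R) (a e : R) :
  L2 X h -> 0 < e ->
  ((\int_[a, a + 1] (fun x => `|h x|))%:E <= (e / 2)%:E +
    (2 * e)^-1%:E * \int[@lebesgue_measure R]_(x in `[a, (a + 1)%R[) (h x ^+ 2)%:E)%E.
Proof.
move=> Lh e0; have lnh := locint_norm (L2_locint Lh); have mh := L2_measurable Lh.
have e20 : 0 < 2 * e by rewrite mulr_gt0.
have young (y : R) : 2 * e * (e / 2 + (2 * e)^-1 * y) = e ^+ 2 + y.
  by field; rewrite gt_eqF.
rewrite fineK; last by apply: integrable_fin_num => //; exact: lnh.2.
rewrite -integral_itv_bndo_bndc; last first.
  by apply/measurable_EFinP/measurable_funTS; exact: lnh.1.
have -> : ((e / 2)%:E = \int[mu]_(x in `[a, (a + 1)%R[) (e / 2)%:E)%E.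
  rewrite integral_cst//= lebesgue_measure_itv/= lte_fin ltrDl ltr01.
  by rewrite -EFinB addrAC subrr add0r mule1.
have mh2 : measurable_fun `[a, a + 1[ (fun x => (h x ^+ 2)%:E).
  by apply/measurable_EFinP/measurable_funTS; exact: measurable_funX.
rewrite -ge0_integralZl//; last 2 first.
- by move=> x _; rewrite lee_fin sqr_ge0.
- by rewrite lee_fin invr_ge0 ltW.
rewrite -ge0_integralD//; last 3 first.
- by move=> x _; rewrite lee_fin divr_ge0// ltW.
- by move=> x _; rewrite -EFinM lee_fin mulr_ge0 ?sqr_ge0// invr_ge0 ltW.
- exact: measurable_funeM.
apply: ge0_le_integral => //.
- by apply/measurable_EFinP/measurable_funTS; exact: lnh.1.
- by apply: emeasurable_funD => //; apply: measurable_funeM.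
- move=> x _; rewrite -EFinM -EFinD lee_fin -[h x ^+ 2]real_normK ?num_real//.
  rewrite -(ler_pM2l e20) young.
  by have := sqr_ge0 (`|h x| - e); rewrite sqrrB; lra.
Qed.

(** Cauchy-Schwarz on a unit interval, from Young's inequality with [e] equal to the norm; the added
    [d] keeps it positive when the norm is 0. *)
Lemma Rint_le_norm2 (R : realType) (X : spatial_domain) (h : R -> R) (a : R) :
  L2 X h -> \int_[a, a + 1] (fun x => `|h x|) <= norm2 X h.
Proof.
move=> Lh; apply/ler_addgt0Pr => d d0.
have N0 := norm2_ge0 X h; set N := norm2 X h in N0 *.
have e0 : 0 < N + d by rewrite ltr_wpDl.
have e20 : 0 < 2 * (N + d) by rewrite mulr_gt0.
rewrite -lee_fin (le_trans (Rint_norm_young a Lh e0))//.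
apply: (@le_trans _ _ (((N + d) / 2)%:E + (2 * (N + d))^-1%:E * (N ^+ 2)%:E)%E).
  by rewrite leeD2l// lee_wpmul2l ?L2_itv1_le// lee_fin invr_ge0 ltW.
rewrite -EFinM -EFinD lee_fin -(ler_pM2l e20).
have -> : 2 * (N + d) * ((N + d) / 2 + (2 * (N + d))^-1 * N ^+ 2) =
    (N + d) ^+ 2 + N ^+ 2 by field; rewrite gt_eqF.
have := mulr_ge0 N0 (ltW d0); have := sqr_ge0 d; rewrite !expr2; nra.
Qed.

(** Dominated convergence for the restrictions of h^2 to the complements of [-n, n]. *)
Lemma Line_tail (R : realType) (h : R -> R) (e : R) : L2 Line h -> 0 < e ->
  exists M, forall a, M < `|a| ->
    (\int[@lebesgue_measure R]_(x in `[a, (a + 1)%R[) (h x ^+ 2)%:E < e%:E)%E.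
Proof.
move=> Lh e0; have mh := L2_measurable Lh.
pose H (x : R) : \bar R := (h x ^+ 2)%:E.
have mH : measurable_fun [set: R] H by apply/measurable_EFinP/measurable_funX.
have H0 x : (0 <= H x)%E by rewrite lee_fin sqr_ge0.
pose A (n : nat) : set R := ~` `[- n%:R, n%:R].
have mA n : measurable (A n) by exact: measurableC.
have iH : (@lebesgue_measure R).-integrable [set: R] H.
  apply/integrableP; split => //; under eq_integral do rewrite gee0_abs//.
  by rewrite -(sqr_norm2 Lh) ltry.
have mHA n : measurable_fun [set: R] (H \_ (A n)).
  have mHn : measurable_fun (A n) H by exact: measurable_funTS.
  by apply/(measurable_restrictT _ _).1.
have hcv : (fun n => \int[@lebesgue_measure R]_x (H \_ (A n)) x)%E @ \oo --> 0%E.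
  have := @dominated_convergence _ _ R (@lebesgue_measure R) [set: R]
    measurableT (fun n => H \_ (A n)) (cst 0%E) H.
  case=> //.
  - apply/aeW => x _; apply: cvg_near_cst; near=> n.
    rewrite patchE memNset// => nA; apply: nA.
    by rewrite /= in_itv/= -ler_norml; near: n; exact: nbhs_infty_ger.
  - by apply/aeW => x n _; rewrite patchE; case: ifPn => _; rewrite ?abse0// gee0_abs.
  - by rewrite integral0.
move/fine_cvgP : hcv => [fin /cvgrPdist_lt /(_ e e0) lim].
have [n [hn1 hn2]] : exists n, (\int[@lebesgue_measure R]_x (H \_ (A n)) x)%E \is a fin_num
    /\ `|0 - fine (\int[@lebesgue_measure R]_x (H \_ (A n)) x)%E| < e.
  have [N _ hN] := filterI fin lim; exists N; exact: (hN N (leqnn N)).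
(* The extra 1 keeps all of [a, a + 1) outside [-n, n] also when [a] is negative. *)
exists (n%:R + 1) => a ha.
apply: (@le_lt_trans _ _ (\int[@lebesgue_measure R]_x (H \_ (A n)) x)%E); last first.
  rewrite -(fineK hn1) lte_fin (le_lt_trans (ler_norm _))//.
  by rewrite -normrN -sub0r.
have mHn : measurable_fun (A n) H by exact: measurable_funTS.
rewrite -integral_mkcond; apply: ge0_subset_integral => //.
- exact: mA.
- by move=> x _; exact: H0.
move=> x /=; rewrite in_itv/= => /andP[ax xa]; rewrite /A/= in_itv/= => /andP[nx xn].
have : `|a| <= n%:R + 1 by rewrite ler_norml; apply/andP; split; lra.
by rewrite leNgt ha.
Unshelve. all: by end_near. Qed.

Lemma Rint_norm_decay (R : realType) (h : R -> R) (e : R) : L2 Line h -> 0 < e ->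
  exists M, forall a, M < `|a| -> \int_[a, a + 1] (fun x => `|h x|) < e.
Proof.
move=> Lh e0; have e2 : 0 < 2 * e by rewrite mulr_gt0.
have [M hM] := Line_tail Lh (mulr_gt0 e0 e0); exists M => a /hM ha.
rewrite -lte_fin (le_lt_trans (Rint_norm_young a Lh e0))//.
have -> : (e%:E = (e / 2)%:E + (2 * e)^-1%:E * (e * e)%:E)%E.
  by rewrite -EFinM -EFinD; congr EFin; field; rewrite gt_eqF.
by rewrite lteD2lE// lte_pmul2l// lte_fin invr_gt0.
Qed.

(** * Continuous representatives *)

Lemma smooth_derive1n (R : realType) (phi : R -> R) (k : nat) :
  smooth phi -> smooth (derive1n k phi).
Proof. by move=> sp; elim: k => [|k IH]; [exact: sp|exact/smooth_derive]. Qed.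

(** On the line [phi] is itself a test function, and on the circle its periodization is one. Testing
    then has the same form on both spaces. *)
Lemma test_unit_itv (R : realType) (X : spatial_domain) (a c d : R) (phi : R -> R) :
  smooth phi -> (forall x, x < c \/ d < x -> phi x = 0) -> a < c -> d < a + 1 ->
  exists2 psi, test_function X psi & forall k h, L2 X h ->
    \int[space_measure R X]_x (h x * derive1n k psi x) =
    \int_[a, a + 1] (fun x => h x * derive1n k phi x).
Proof.
move=> sp out ac da.
have key k h (psi : R -> R) : L2 X h -> continuous psi ->
   (forall x, a <= x < a + 1 -> psi x = derive1n k phi x) ->
   match X with
   | Line => forall x, ~ (a <= x < a + 1) -> psi x = 0
   | Circle => forall x, psi (x + 1) = psi x
   end ->
   \int[space_measure R X]_x (h x * psi x) =
   \int_[a, a + 1] (fun x => h x * derive1n k phi x).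
  move=> Lh cpsi psiE hX; have lh := L2_locint Lh.
  have cphi : continuous (derive1n k phi) by exact/smooth_continuous/smooth_derive1n.
  rewrite /Rintegral (@space_integral _ X a); last 2 first.
  - by apply/measurable_EFinP; exact: (locintM lh cpsi).1.
  - case: X hX Lh => hX Lh x; first by move=> xa; rewrite hX// mulr0.
    by rewrite hX Lh.1.
  congr fine; rewrite -integral_itv_bndo_bndc; last first.
    by apply/measurable_EFinP/measurable_funTS; exact: (locintM lh cphi).1.
  by apply: eq_integral => x; rewrite inE/= in_itv/= => xa; rewrite psiE.
case: X key => key.
  exists phi => [|k h Lh].
    split => //; exists (`|c| + `|d|) => x hx; apply: out.
    have [x0|x0] := leP 0 x; [right|left].
      by move: hx; rewrite (ger0_norm x0); have := ler_norm d; have := normr_ge0 c; lra.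
    by move: hx; rewrite (ltr0_norm x0); have := ler_norm (- c); rewrite normrN;
      have := normr_ge0 d; lra.
  apply: key => //; first exact/smooth_continuous/smooth_derive1n.
  move=> x xa; apply: (derive1n_out k out).
  have [xc|xc] := ltP x c; [by left|right].
  rewrite ltNge; apply/negP => xd; apply: xa; apply/andP; split; lra.
have sper := smooth_periodize sp out ac da.
have Dper k := derive1n_periodize k sp out ac da.
exists (periodize a phi) => [|k h Lh].
  by split => //; exact: periodic_periodize.
apply: key => //; first exact/smooth_continuous/smooth_derive1n.
  by move=> x xa; rewrite Dper periodize_id.
by move=> x; rewrite Dper; exact: periodic_periodize.
Qed.

Lemma Rint_out (R : realType) (F : R -> R) (a b : R) :
  (forall x, a <= x <= b -> F x = 0) -> \int_[a, b] F = 0.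
Proof.
move=> F0; rewrite [LHS](_ : _ = \int_[a, b] (fun=> 0)).
  by rewrite /Rintegral integral0.
by apply: eq_Rintegral => x; rewrite inE/= in_itv/=; exact: F0.
Qed.

Lemma continuous_out (R : realType) (c d : R) (F : R -> R) : continuous F ->
  (forall x, x < c \/ d < x -> F x = 0) ->
  forall x, x <= c \/ d <= x -> F x = 0.
Proof.
move=> cF F0 x hx; have F0c (y : R) (A : set_system R) : ProperFilter A -> A --> y ->
    (\forall z \near A, F z = 0) -> F y = 0.
  move=> PA Ay A0; have h1 : F z @[z --> A] --> F y by exact: (cvg_comp id F Ay (cF y)).
  have h2 : F z @[z --> A] --> (0 : R).
    by apply: cvg_near_cst.
  exact: (norm_cvg_unique h1 h2).
case: hx => hx; [apply: (F0c x x^'-)|apply: (F0c x x^'+)].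
- exact: cvg_at_left_filter cvg_id.
- near=> z; apply: F0; left; apply: lt_le_trans hx; near: z.
  exact: nbhs_left_lt.
- exact: cvg_at_right_filter cvg_id.
- near=> z; apply: F0; right; apply: le_lt_trans hx _; near: z.
  exact: nbhs_right_gt.
Unshelve. all: by end_near. Qed.

(** The restriction [d - c < 1] lets the segment fit strictly inside a unit interval, as
    periodization demands; longer distances are reached later in short steps. *)
Lemma L2_increment (R : realType) (X : spatial_domain) (f g : R -> R) (c d : R) :
  L2 X f -> is_weak_derivative X 1 f g -> c < d -> d - c < 1 ->
  lebesgue_pt f c -> lebesgue_pt f d -> f d - f c = \int_[c, d] g.
Proof.
move=> Lf [Lg wfg] cd dc1 fc fd; have lf := L2_locint Lf; have lg := L2_locint Lg.
apply: weak_derivative_increment => // phi sp out.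
(* This leaves the same margin, (1 - (d - c)) / 2, on both sides of [c, d]. *)
pose a := (c + d - 1) / 2.
have ac : a < c by rewrite /a; lra.
have da : d < a + 1 by rewrite /a; lra.
have out' x : x < c \/ d < x -> phi x = 0.
  by move=> hx; apply: out; case: hx => /ltW; auto.
have [psi tpsi psiE] := test_unit_itv X sp out' ac da.
have := wfg psi tpsi; rewrite expr1 mulN1r psiE// (psiE 0 g Lg)/=.
have reduce (k : nat) (h : R -> R) : locint h ->
    \int_[a, a + 1] (fun x => h x * derive1n k phi x) =
    \int_[c, d] (fun x => h x * derive1n k phi x).
  move=> lh; have lhk : locint (fun x => h x * derive1n k phi x).
    by apply: locintM => //; exact/smooth_continuous/smooth_derive1n.
  have zero x : (x <= c \/ d <= x) -> derive1n k phi x = 0.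
    apply: continuous_out (derive1n_out k out') x.
    exact/smooth_continuous/smooth_derive1n.
  rewrite (@Rint_chasles _ _ a c (a + 1))//; last by apply/andP; split; lra.
  rewrite (@Rint_chasles _ _ c d (a + 1))//; last by apply/andP; split; lra.
  rewrite (@Rint_out _ _ a c) ?add0r; last first.
    by move=> x /andP[_ xc]; rewrite zero ?mulr0//; left.
  rewrite (@Rint_out _ _ d (a + 1)) ?addr0//.
  by move=> x /andP[xc _]; rewrite zero ?mulr0//; right.
by rewrite (reduce 1 _ lf) (reduce 0 _ lg).
Qed.

Lemma ae_dense (R : realType) (P : R -> Prop) (x y : R) :
  {ae @lebesgue_measure R, forall z, P z} -> x < y -> exists2 z, x < z < y & P z.
Proof.
move=> [N [mN N0 PN]] xy; apply: contrapT => hn.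
have sub : `]x, y[ `<=` N.
  move=> z /=; rewrite in_itv/= => xzy; apply: PN => Pz.
  by apply: hn; exists z.
have : (@lebesgue_measure R `]x, y[ <= 0)%E.
  by rewrite -N0; apply: le_measure => //; rewrite inE.
by rewrite lebesgue_measure_itv/= lte_fin xy -EFinB lee_fin leNgt subr_gt0 xy.
Qed.

(* The integral over a segment with reversed bounds is 0, so that this is the
   signed integral from 0 to [x]. *)
Definition prim (R : realType) (g : R -> R) (x : R) : R :=
  \int_[0, x] g - \int_[x, 0] g.

Lemma prim_increment (R : realType) (g : R -> R) (a b : R) : locint g -> a <= b ->
  prim g b - prim g a = \int_[a, b] g.
Proof.
move=> lg ab; have neg x y : y < x -> \int_[x, y] g = 0.
  move=> xy; by rewrite set_itv_ge ?Rintegral_set0// bnd_simp -ltNge.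
have z0 x : 0 < x -> \int_[x, 0] g = 0 by exact: neg.
rewrite /prim; have [b0|b0] := leP b 0.
  have E (x : R) : x <= 0 -> \int_[0, x] g = 0.
    by rewrite le_eqVlt => /predU1P[->|/neg//]; rewrite Rint_point.
  rewrite (E b)// (E a); last lra.
  rewrite (@Rint_chasles _ _ a b 0)//; [ring|by apply/andP; split].
rewrite (z0 b)//; have [a0|a0] := leP a 0.
  have E : \int_[0, a] g = 0.
    by move: a0; rewrite le_eqVlt => /predU1P[->|/neg//]; rewrite Rint_point.
  rewrite E (@Rint_chasles _ _ a 0 b)//; [ring|by apply/andP; split; lra].
rewrite (z0 a)// (@Rint_chasles _ _ 0 a b)//; [ring|by apply/andP; split; lra].
Qed.

Lemma increment_continuous (R : realType) (G g : R -> R) : locint g ->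
  (forall a b, a <= b -> G b - G a = \int_[a, b] g) -> continuous G.
Proof.
move=> lg Gg x; have x1 : x - 1 <= x + 1 by lra.
have := @parameterized_integral_continuous R (x - 1) (x + 1) g x1 (lg.2 _ _).
have x2 : x - 1 < x + 1 by lra.
move/continuous_within_itvP => /(_ x2) [h _ _].
have xin : x \in `]x - 1, x + 1[ by rewrite in_itv/=; apply/andP; split; lra.
have {h} := h x xin; rewrite /parameterized_integral => h.
have h2 := cvgD (cvg_cst (G (x - 1))) h.
have EG y : x - 1 <= y -> G y = G (x - 1) + \int_[x - 1, y] g.
  by move=> xy; have := Gg _ _ xy => <-; rewrite addrC subrK.
rewrite /continuous_at (EG x); last lra.
apply: cvg_trans (h2 _ _); apply: near_eq_cvg; near=> y.
rewrite fctE /= -EG//.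
by apply/ltW; near: y; apply: lt_nbhsr; lra.
Unshelve. all: by end_near. Qed.

Lemma on_space_derive1 (R : realType) (X : spatial_domain) (f : R -> R) :
  (forall x : R, derivable f x 1) -> on_space X f -> on_space X (derive1 f).
Proof.
case: X => //= df pf x; have fs : (fun y => f (1 * y + 1)) = f.
  by apply/funext => y; rewrite mul1r pf.
have : is_derive (1 * x + 1) 1 f (derive1 f (1 * x + 1)) by apply/is_derive1P.
by move=> /is_derive1_affine; rewrite fs !mul1r => /is_derive1P[].
Qed.

Lemma test_function_derive1 (R : realType) (X : spatial_domain) (psi : R -> R) :
  test_function X psi -> test_function X (derive1 psi).
Proof.
move=> [sp op cp]; split; first exact: smooth_derive.
  by apply: on_space_derive1 => //; exact: (sp 0).
case: X cp op => // -[M hM] _; exists M => x Mx.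
have out y : y < - M \/ M < y -> psi y = 0.
  move=> hy; apply: hM; case: hy => hy; last exact: (lt_le_trans hy (ler_norm _)).
  by rewrite -normrN (lt_le_trans _ (ler_norm _))// ltrNr.
apply: (derive1_out out); have [x0|x0] := leP 0 x; [right|left].
  by rewrite ger0_norm in Mx.
by rewrite ltr0_norm// in Mx; rewrite ltrNr.
Qed.

Lemma test_function_derive1n (R : realType) (X : spatial_domain) (psi : R -> R) (k : nat) :
  test_function X psi -> test_function X (derive1n k psi).
Proof. by move=> tp; elim: k => // k IH; exact: test_function_derive1. Qed.

Lemma L2I (R : realType) (X : spatial_domain) (h : R -> R) :
  on_space X h -> measurable_fun [set: R] h ->
  (\int[space_measure R X]_x (h x ^+ 2)%:E < +oo)%E -> L2 X h.
Proof.
move=> oh mh hfin; split => //; rewrite inE; apply/andP; split; rewrite inE//=.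
rewrite /finite_norm; apply: (@lty_poweRy _ _ 2) => //.
rewrite poweR_Lnorm//; apply: le_lt_trans hfin.
rewrite le_eqVlt; apply/orP; left; apply/eqP; apply: eq_integral => x _.
by rewrite /= powR_mulrn// real_normK// num_real.
Qed.

Lemma test_function_L2 (R : realType) (X : spatial_domain) (psi : R -> R) :
  test_function X psi -> L2 X psi.
Proof.
move=> [sp op cp]; have cpsi := smooth_continuous sp.
have lp2 : locint (fun x => psi x ^+ 2).
  by apply: locint_continuous => x; apply: cvgM; exact: cpsi.
have mp2 : measurable_fun [set: R] (fun x => (psi x ^+ 2)%:E).
  by apply/measurable_EFinP; exact: lp2.1.
have fin a b : (\int[@lebesgue_measure R]_(x in `[a, b]) (psi x ^+ 2)%:E < +oo)%E.
  have /integrableP[_] := lp2.2 a b; apply: le_lt_trans; apply: ge0_le_integral => //.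
  - by move=> x _; rewrite lee_fin sqr_ge0.
  - exact: measurable_funTS.
  - by apply: measurableT_comp => //; exact: measurable_funTS.
  - by move=> x _ /=; rewrite lee_fin ler_norm.
apply: L2I => //; first exact: continuous_measurable_fun.
case: X op cp => op cp.
  have [M hM] := cp; apply: le_lt_trans (fin (- M) M).
  rewrite [leRHS]integral_mkcond le_eqVlt; apply/orP; left; apply/eqP.
  apply: eq_integral => x _; rewrite patchE; case: ifPn => //.
  rewrite notin_setE/= in_itv/= -ler_norml => /negP; rewrite -ltNge => /hM ->.
  by rewrite expr0n.
rewrite (@space_integral _ _ 0)//; last by move=> x; rewrite op.
apply: le_lt_trans (fin 0 (0 + 1)); apply: ge0_subset_integral => //.
- exact: measurable_funTS.
- by move=> x _; rewrite lee_fin sqr_ge0.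
- by apply: subset_itvl; rewrite bnd_simp.
Qed.

Lemma L2_test_integrable (R : realType) (X : spatial_domain) (f psi : R -> R) :
  L2 X f -> test_function X psi ->
  (space_measure R X).-integrable setT (EFin \o (fun x => f x * psi x)).
Proof.
move=> [_ Lf] /test_function_L2[_ Lp]; apply/Lfun1_integrable.
exact: Lfun2_mul_Lfun1.
Qed.

Lemma L2_lin (R : realType) (X : spatial_domain) (a : R) (f g : R -> R) :
  L2 X f -> L2 X g -> L2 X (fun x => a * f x + g x).
Proof.
move=> [of1 Lf] [og Lg]; split.
  by case: X of1 og {Lf Lg} => //= of1 og x; rewrite of1 og.
have := (@Lfun_submod_closed _ _ R (space_measure R X) 2%:E (lee1n 2)).2 a f g Lf Lg.
by [].
Qed.

Lemma weak_lin (R : realType) (X : spatial_domain) (k : nat) (a : R)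
    (f g F G : R -> R) : L2 X f -> L2 X g ->
  is_weak_derivative X k f F -> is_weak_derivative X k g G ->
  is_weak_derivative X k (fun x => a * f x + g x) (fun x => a * F x + G x).
Proof.
move=> Lf Lg [LF wF] [LG wG]; split; first exact: L2_lin.
have key (u v psi : R -> R) : L2 X u -> L2 X v -> test_function X psi ->
  \int[space_measure R X]_x ((a * u x + v x) * psi x) =
  a * \int[space_measure R X]_x (u x * psi x) + \int[space_measure R X]_x (v x * psi x).
  move=> Lu Lv tp; have iu := L2_test_integrable Lu tp; have iv := L2_test_integrable Lv tp.
  rewrite -RintegralZl// -RintegralD//; last exact: (integrableZl measurableT a iu).
  by apply: eq_Rintegral => x _; rewrite mulrDl mulrA.
move=> psi tp; rewrite !key//; last exact: test_function_derive1n.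
by rewrite wF// wG// mulrDr; congr (_ + _); rewrite !mulrA [a * _]mulrC.
Qed.

(** Testing order [k.+1] against [psi] amounts to testing order [k] against its derivative, and the
    sign [(-1) ^+ k] cancels. *)
Lemma weak_derivative_step (R : realType) (X : spatial_domain) (k : nat) (f g h : R -> R) :
  is_weak_derivative X k f g -> is_weak_derivative X k.+1 f h ->
  is_weak_derivative X 1 g h.
Proof.
move=> [Lg wg] [Lh wh]; split => // psi tp.
have := wh psi tp; rewrite derive1Sn wg; last exact: test_function_derive1.
rewrite exprS -mulrA expr1 => E; apply: (mulfI (_ : (-1 : R) ^+ k != 0)).
  by rewrite expf_neq0// oppr_eq0 oner_eq0.
by rewrite E mulrCA.
Qed.

Lemma Sobolev_lin (R : realType) (X : spatial_domain) (s : nat) (a : R) (f g : R -> R) :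
  Sobolev X s f -> Sobolev X s g -> Sobolev X s (fun x => a * f x + g x).
Proof.
move=> [Lf wf] [Lg wg]; split; first exact: L2_lin.
move=> k ks; have [F hF] := wf k ks; have [G hG] := wg k ks.
by eexists; apply: weak_lin hF hG.
Qed.

Lemma weak_derivativeP (R : realType) (X : spatial_domain) (s k : nat) (f : R -> R) :
  Sobolev X s f -> (k <= s)%N -> is_weak_derivative X k f (weak_derivative X k f).
Proof. by move=> [_ wf] ks; apply: (@xgetPex _ (cst 0)); exact: wf. Qed.

Lemma norm2_le_Sobolev (R : realType) (X : spatial_domain) (s k : nat) (f : R -> R) :
  (k <= s)%N -> norm2 X (weak_derivative X k f) <= Sobolev_norm X s f.
Proof.
move=> ks; rewrite /Sobolev_norm -[leLHS]ger0_norm ?norm2_ge0// -sqrtr_sqr.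
rewrite ler_sqrt; last by rewrite sumr_ge0// => i _; rewrite sqr_ge0.
have ks' : (k < s.+1)%N by [].
rewrite (bigD1 (Ordinal ks'))//= lerDl sumr_ge0// => i _.
by rewrite sqr_ge0.
Qed.

Lemma space_ae (R : realType) (X : spatial_domain) (P : R -> Prop) :
  {ae @lebesgue_measure R, forall x, P x} -> {ae space_measure R X, forall x, P x}.
Proof.
case: X => //= -[N [mN N0 PN]]; exists N; split => //.
apply/eqP; rewrite eq_le measure_ge0 andbT -N0 /= /mrestr.
by apply: le_measure; rewrite ?inE//; exact: measurableI.
Qed.

Lemma L2_ae (R : realType) (X : spatial_domain) (f G : R -> R) :
  L2 X f -> on_space X G -> measurable_fun [set: R] G ->
  {ae @lebesgue_measure R, forall x, G x = f x} ->
  [/\ L2 X G, norm2 X G = norm2 X f & forall psi, measurable_fun [set: R] psi ->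
    \int[space_measure R X]_x (G x * psi x) = \int[space_measure R X]_x (f x * psi x)].
Proof.
move=> Lf oG mG /(space_ae X) Gf; have mf := L2_measurable Lf.
have sqE : (\int[space_measure R X]_x (G x ^+ 2)%:E = \int[space_measure R X]_x (f x ^+ 2)%:E)%E.
  apply: ge0_ae_eq_integral => //.
  - by apply/measurable_EFinP; exact: measurable_funX.
  - by apply/measurable_EFinP; exact: measurable_funX.
  - by move=> x _; rewrite lee_fin sqr_ge0.
  - by move=> x _; rewrite lee_fin sqr_ge0.
  - have [N [mN N0 PN]] := Gf; exists N; split => // x hx; apply: PN => /= E.
    by apply: hx => _; rewrite E.
have LG : L2 X G by apply: L2I => //; rewrite sqE -sqr_norm2// ltry.
split => //.
  have := sqr_norm2 LG; rewrite sqE -sqr_norm2// => -[] /eqP.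
  by rewrite eqrXn2 ?norm2_ge0// => /eqP.
move=> psi mpsi; congr fine; apply: ae_eq_integral => //.
- by apply/measurable_EFinP; exact: measurable_funM.
- by apply/measurable_EFinP; exact: measurable_funM.
- have [N [mN N0 PN]] := Gf; exists N; split => // x hx; apply: PN => /= E.
  by apply: hx => _; rewrite E.
Qed.

Lemma ae_lebesgue_pt (R : realType) (f : R -> R) : locint f ->
  {ae @lebesgue_measure R, forall x, lebesgue_pt f x}.
Proof. by move=> /locint_locally /lebesgue_differentiation. Qed.

(** The increment formula covers gaps below 1 only, so [p] is approached through intermediate
    Lebesgue points, which are dense. Each step has length between 1/2 and 3/4: short enough for the
    formula, long enough for the induction on [n]. *)
Lemma lebesgue_pt_prim (R : realType) (X : spatial_domain) (f g : R -> R) (p x : R) :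
  L2 X f -> is_weak_derivative X 1 f g -> lebesgue_pt f p -> lebesgue_pt f x ->
  f x - prim g x = f p - prim g p.
Proof.
move=> Lf wfg fp; have lf := L2_locint Lf; have lg := L2_locint wfg.1.
have close y z : lebesgue_pt f y -> lebesgue_pt f z -> y < z -> z - y < 1 ->
    f y - prim g y = f z - prim g z.
  move=> fy fz yz zy1; have E := L2_increment Lf wfg yz zy1 fy fz.
  by have := prim_increment lg (ltW yz); rewrite -E; lra.
suff H (n : nat) y : lebesgue_pt f y -> `|y - p| <= n%:R / 2 ->
    f y - prim g y = f p - prim g p.
  move=> fx; apply: (H (Num.truncn (2 * `|x - p|)).+1 x fx).
  by rewrite ler_pdivlMr// mulrC ltW// truncnS_gt.
elim: n y => [|n IH] y fy.
  by rewrite mul0r normr_le0 subr_eq0 => /eqP ->.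
rewrite -natr1 => yn; have [|yp|->//] := ltgtP y p.
- move=> yp; have [py1|py1] := ltP (p - y) 1; first exact: close.
  have yy : y + 2^-1 < y + 3 / 4 by lra.
  have [z /andP[z1 z2] fz] := ae_dense (ae_lebesgue_pt lf) yy.
  rewrite (close y z)//; [|lra|lra]; apply: IH => //.
  by move: yn; rewrite !ltr0_norm; lra.
- have [py1|py1] := ltP (y - p) 1; first by apply/esym; exact: close.
  have yy : y - 3 / 4 < y - 2^-1 by lra.
  have [z /andP[z1 z2] fz] := ae_dense (ae_lebesgue_pt lf) yy.
  rewrite -(close z y)//; [|lra|lra]; apply: IH => //.
  by move: yn; rewrite !gtr0_norm; lra.
Qed.

(* Test against the constant function 1. *)
Lemma Circle_mean0 (R : realType) (f g : R -> R) (a : R) :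
  L2 Circle f -> is_weak_derivative Circle 1 f g -> \int_[a, a + 1] g = 0.
Proof.
move=> Lf [Lg wfg]; have lg := L2_locint Lg.
have t1 : test_function Circle (fun _ : R => 1 : R).
  split => //; apply/smooth_diffn => n; exact: diffn_cst.
have := wfg _ t1; rewrite derive1n1 (is_derive1_ext (fun x => is_derive_cst (1 : R) x 1)).
under eq_Rintegral do rewrite mulr0.
rewrite [X in X = _ -> _](_ : _ = 0); last by rewrite /Rintegral integral0.
under eq_Rintegral do rewrite mulr1.
move/esym/eqP; rewrite expr1 mulN1r oppr_eq0 => /eqP E.
rewrite -[RHS]E /Rintegral (@space_integral _ Circle a) => [||x]; last 2 first.
- by apply/measurable_EFinP; exact: lg.1.
- by rewrite Lg.1.
congr fine; rewrite -integral_itv_bndo_bndc//.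
by apply/measurable_EFinP/measurable_funTS; exact: lg.1.
Qed.

(** The translate of [prim g] that agrees with [f] at one Lebesgue point agrees with it at all of
    them, hence almost everywhere. On the circle it is periodic because [g] has mean 0. *)
Lemma continuous_representative (R : realType) (X : spatial_domain) (f g : R -> R) :
  L2 X f -> is_weak_derivative X 1 f g ->
  exists G, [/\ continuous G, on_space X G,
    {ae @lebesgue_measure R, forall x, G x = f x} &
    forall a b, a <= b -> G b - G a = \int_[a, b] g].
Proof.
move=> Lf wfg; have lf := L2_locint Lf; have lg := L2_locint wfg.1.
have ae_pt := ae_lebesgue_pt lf; have [p _ fp] := ae_dense ae_pt (@ltr01 R).
pose G x := prim g x + (f p - prim g p).
have Ginc a b : a <= b -> G b - G a = \int_[a, b] g.
  by move=> ab; rewrite -prim_increment// /G; ring.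
exists G; split => //.
- exact: increment_continuous Ginc.
- case: X Lf wfg => //= Lf wfg x; apply/eqP; rewrite -subr_eq0 Ginc; last lra.
  by rewrite (Circle_mean0 _ Lf wfg).
- apply: (@filterS _ _ (ae_filter_ringOfSetsType _)) ae_pt => x fx.
  by rewrite /G -(lebesgue_pt_prim Lf wfg fp fx); ring.
Qed.

Lemma ae_eq_continuous (R : realType) (F G : R -> R) : continuous F -> continuous G ->
  {ae @lebesgue_measure R, forall x, F x = G x} -> F = G.
Proof.
move=> cF cG FG; apply/funext => x; apply/eqP; rewrite -subr_eq0; apply/negPn/negP => D0.
have cD : {for x, continuous (fun y => F y - G y)} by apply: cvgB; [exact: cF|exact: cG].
have /cvgr_neq0 /(_ D0) : F y - G y @[y --> x] --> F x - G x by exact: cD.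
move=> /nbhs_ballP[e /= e0 he].
have xe : x < x + e by rewrite ltrDl.
have [z /andP[xz ze] Ez] := ae_dense FG xe.
have : F z - G z != 0.
  by apply: he; rewrite /ball/= ltr0_norm ?subr_lt0// opprB ltrBlDl.
by rewrite Ez subrr eqxx.
Qed.

Lemma increment_derive (R : realType) (G h : R -> R) (x : R) : continuous h ->
  (forall a b, a <= b -> G b - G a = \int_[a, b] h) -> is_derive x 1 G (h x).
Proof.
move=> ch Gh; have [_ lh] := locint_continuous ch.
have x1 : x < x + 1 by lra.
have x2 : x - 1 < x by lra.
have [d1 d2] := continuous_FTC1_closed x1 (lh (x - 1) (x + 1)) x2 (ch x).
have D : is_derive x 1 (fun y => \int_[x - 1, y] h) (h x) by apply/is_derive1P.
have D2 := is_derive1D D (is_derive_cst (G (x - 1)) x 1).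
rewrite addr0 in D2; apply: near_eq_is_derive D2.
near=> y; have xy : x - 1 <= y by apply/ltW; near: y; exact: lt_nbhsr.
by rewrite -(Gh _ _ xy) subrK.
Unshelve. all: by end_near. Qed.

(** For every y in [x, x + 1], |G x| is at most |G y| plus the integral of |g|; averaging over y
    gives the bound. *)
Lemma increment_sup_bound (R : realType) (G g : R -> R) (x : R) :
  continuous G -> locint g ->
  (forall a b, a <= b -> G b - G a = \int_[a, b] g) ->
  `|G x| <= \int_[x, x + 1] (fun y => `|G y|) + \int_[x, x + 1] (fun y => `|g y|).
Proof.
move=> cG lg Gg; have lng := locint_norm lg; have lG := locint_norm (locint_continuous cG).
set c := \int_[x, x + 1] (fun y => `|g y|).
have le1 y : x <= y <= x + 1 -> `|G x| - c <= `|G y|.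
  move=> /andP[xy yx]; have : `|G y - G x| <= c.
    rewrite Gg//; apply: (le_trans (le_normr_Rintegral _ (lg.2 _ _))) => //.
    rewrite /c (@Rint_chasles _ _ x y (x + 1))//; last by rewrite xy.
    by rewrite lerDl; exact: Rintegral_ge0.
  have := ler_normB (G y) (G y - G x); rewrite opprB addrC subrK; lra.
have : \int_[x, x + 1] (fun=> `|G x| - c) <= \int_[x, x + 1] (fun y => `|G y|).
  apply: (le_Rintegral _ ((locint_cst (`|G x| - c)).2 x (x + 1)) (lG.2 x (x + 1))) => //.
rewrite Rintegral_cst//= lebesgue_measure_itv/= lte_fin ltrDl ltr01.
by rewrite -EFinB/= addrAC subrr add0r mulr1 lerBlDr.
Qed.

(** Trapezoids supported in [1/4, 3/4], inside the unit interval, provide tests on both spaces;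
    their integrals against [c] tend to [c * (b - a)]. *)
Lemma test_orthogonal_cst (R : realType) (X : spatial_domain) (c : R) (h : R -> R) :
  L2 X h -> (forall x, h x = c) ->
  (forall psi, test_function X psi -> \int[space_measure R X]_x (h x * psi x) = 0) ->
  c = 0.
Proof.
move=> Lh hc h0; pose a : R := 1 / 4; pose b : R := 3 / 4.
have ab : a < b by rewrite /a /b; lra.
have lim := plateau_cvg (locint_cst c) ab.
have z r : 0 < r -> r <= b - a -> \int_[a, b] (fun x => c * plateau a b r x) = 0.
  move=> r0 rab; have out x : x < a \/ b < x -> plateau a b r x = 0.
    by have [h1 h2] := plateau_out x r0 rab; case=> /ltW; auto.
  have a0 : 0 < a by rewrite /a; lra.
  have b1 : b < 0 + 1 by rewrite /b; lra.
  have [psi tpsi psiE] := test_unit_itv X (@smooth_plateau R a b r) out a0 b1.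
  have := h0 psi tpsi; rewrite (psiE 0 h Lh).
  under eq_Rintegral do rewrite hc.
  have lcp : locint (fun x => c * plateau a b r x).
    by apply: locintZ; exact/locint_continuous/smooth_continuous/smooth_plateau.
  rewrite (@Rint_chasles _ _ 0 a (0 + 1))//; last by apply/andP; split; lra.
  rewrite (@Rint_chasles _ _ a b (0 + 1))//; last by apply/andP; split; lra.
  have [h1 h2] := (fun x => (plateau_out x r0 rab).1, fun x => (plateau_out x r0 rab).2).
  rewrite (@Rint_out _ _ 0 a); last by move=> x /andP[_ /h1 hx]; rewrite /= hx mulr0.
  rewrite (@Rint_out _ _ b (0 + 1)); last first.
    by move=> x /andP[/h2 hx _]; rewrite /= hx mulr0.
  by rewrite addr0 [X in X = _ -> _]add0r.
have lim0 : \int_[a, b] (fun x => c * plateau a b r x) @[r --> 0^'+] --> (0 : R).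
  apply: cvg_near_cst; near=> r; apply: z; near: r; first exact: nbhs_right_gt.
  by apply: nbhs_right_le; rewrite subr_gt0.
have E : \int_[a, b] (fun=> c) = 0 by exact: (norm_cvg_unique lim lim0).
move: E; rewrite Rintegral_cst//= lebesgue_measure_itv/= lte_fin ab -EFinB/=.
by move/eqP; rewrite mulf_eq0 subr_eq0 (gt_eqF ab) orbF => /eqP.
Unshelve. all: by end_near. Qed.

(** * Sobolev embedding *)

Lemma Rint_ae (R : realType) (F H : R -> R) (a b : R) : locint F -> locint H ->
  {ae @lebesgue_measure R, forall x, F x = H x} -> \int_[a, b] F = \int_[a, b] H.
Proof.
move=> [mF _] [mH _] FH; congr fine; apply: ae_eq_integral => //.
- by apply/measurable_EFinP; exact: measurable_funTS.
- by apply/measurable_EFinP; exact: measurable_funTS.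
- by apply: (@filterS _ _ (ae_filter_ringOfSetsType _)) FH => x /= ->.
Qed.

Lemma weak_derivative_ae (R : realType) (X : spatial_domain) (k : nat) (f G h : R -> R) :
  L2 X f -> on_space X G -> measurable_fun [set: R] G ->
  {ae @lebesgue_measure R, forall x, G x = f x} ->
  is_weak_derivative X k G h <-> is_weak_derivative X k f h.
Proof.
move=> Lf oG mG Gf; have [_ _ E] := L2_ae Lf oG mG Gf.
have Ek psi : test_function X psi ->
    \int[space_measure R X]_x (G x * derive1n k psi x) =
    \int[space_measure R X]_x (f x * derive1n k psi x).
  move=> /(test_function_derive1n k)[sp _ _]; apply: E.
  by apply: continuous_measurable_fun; exact: smooth_continuous.
by split=> -[Lh wh]; split => // psi tp; rewrite -wh// Ek.
Qed.

Lemma Sobolev_ae (R : realType) (X : spatial_domain) (s : nat) (f G : R -> R) :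
  Sobolev X s f -> on_space X G -> measurable_fun [set: R] G ->
  {ae @lebesgue_measure R, forall x, G x = f x} ->
  Sobolev X s G.
Proof.
move=> [Lf wf] oG mG Gf; have [LG _ _] := L2_ae Lf oG mG Gf.
split => // k /wf[h wh]; exists h.
by have [_ H] := @weak_derivative_ae R X k f G h Lf oG mG Gf; exact: H.
Qed.

Lemma Sobolev_norm_ae (R : realType) (X : spatial_domain) (s : nat) (f G : R -> R) :
  L2 X f -> on_space X G -> measurable_fun [set: R] G ->
  {ae @lebesgue_measure R, forall x, G x = f x} ->
  Sobolev_norm X s G = Sobolev_norm X s f.
Proof.
move=> Lf oG mG Gf; rewrite /Sobolev_norm; congr Num.sqrt; apply: eq_bigr => k _.
rewrite /weak_derivative.
have -> : [set g | is_weak_derivative X k G g] = [set g | is_weak_derivative X k f g].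
  by apply/funext => g; apply/propext; exact: weak_derivative_ae.
by [].
Qed.

Lemma Sobolev_chain (R : realType) (X : spatial_domain) (s : nat) (v : R -> R) :
  Sobolev X s v -> exists G : nat -> R -> R, forall k, (k < s)%N ->
  [/\ continuous (G k), on_space X (G k),
    {ae @lebesgue_measure R, forall x, G k x = weak_derivative X k v x} &
    forall a b, a <= b -> G k b - G k a = \int_[a, b] (weak_derivative X k.+1 v)].
Proof.
move=> Sv.
have /choice[G hG] : forall k, exists Gk : R -> R, (k < s)%N ->
  [/\ continuous Gk, on_space X Gk,
    {ae @lebesgue_measure R, forall x, Gk x = weak_derivative X k v x} &
    forall a b, a <= b -> Gk b - Gk a = \int_[a, b] (weak_derivative X k.+1 v)].
  move=> k; have [ks|ks] := boolP (k < s)%N; last by exists (cst 0).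
  have wk := weak_derivativeP Sv (ltnW ks); have wk1 := weak_derivativeP Sv ks.
  have [G hG] := continuous_representative wk.1 (weak_derivative_step wk wk1).
  by exists G.
by exists G.
Qed.

(** The weak derivative of order 0 is a choice, tied to [v] only through test functions. Both [G0]
    and [v] have the same increments, so they differ by a constant, and that constant is orthogonal
    to every test function. *)
Lemma Sobolev_chain0 (R : realType) (X : spatial_domain) (s : nat) (v G0 : R -> R) :
  Sobolev X s v -> (0 < s)%N -> continuous v -> continuous G0 -> on_space X G0 ->
  {ae @lebesgue_measure R, forall x, G0 x = weak_derivative X 0 v x} ->
  (forall a b, a <= b -> G0 b - G0 a = \int_[a, b] (weak_derivative X 1 v)) -> G0 = v.
Proof.
move=> Sv s0 cv cG oG aeG incG.
have [Lv _] := Sv; have w0 := weak_derivativeP Sv (leq0n s); have w1 := weak_derivativeP Sv s0.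
have [V [cV _ aeV incV]] := continuous_representative Lv w1.
have EV : V = v by exact: ae_eq_continuous aeV.
have [LG _ EG] := L2_ae w0.1 oG (continuous_measurable_fun cG) aeG.
pose c := G0 0 - v 0.
have hc x : -1 * v x + G0 x = c.
  rewrite -EV in cv *; rewrite mulN1r addrC /c.
  have [x0|/ltW x0] := leP 0 x.
    by have := incG _ _ x0; have := incV _ _ x0; rewrite -EV; lra.
  by have := incG _ _ x0; have := incV _ _ x0; rewrite -EV; lra.
have c0 : c = 0.
  apply: (@test_orthogonal_cst R X c (fun x => -1 * v x + G0 x)) => //.
    exact: L2_lin.
  move=> psi tp; have iv := L2_test_integrable Lv tp; have iG := L2_test_integrable LG tp.
  under eq_Rintegral do rewrite mulN1r addrC mulrBl.
  rewrite RintegralB// EG; last first.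
    by apply: continuous_measurable_fun; apply: smooth_continuous; case: tp.
  by apply/eqP; rewrite subr_eq0; apply/eqP; have := w0.2 psi tp; rewrite expr0 mul1r => <-.
by apply/funext => x; have := hc x; rewrite c0 mulN1r => /eqP; rewrite addrC subr_eq0 => /eqP.
Qed.

(** The factor 2 counts the two integrals of the sup bound, for the derivatives of orders [k] and
    [k.+1]. Decay on the line follows from the same bound, both integrals being small far out. *)
Lemma Sobolev_embedding (R : realType) (X : spatial_domain) (s k : nat) (v : R -> R) :
  Sobolev X s v -> continuous v -> (k < s)%N ->
  [/\ continuous (derive1n k v), on_space X (derive1n k v),
    forall x, `|derive1n k v x| <= 2 * Sobolev_norm X s v,
    (k.+1 < s)%N -> forall x, derivable (derive1n k v) x 1 &
    X = Line -> forall e, 0 < e -> exists M, forall x, M < `|x| -> `|derive1n k v x| < e].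
Proof.
move=> Sv cv; have [G hG] := Sobolev_chain Sv.
have lw j : (j <= s)%N -> locint (weak_derivative X j v).
  by move=> js; have [Lw _] := weak_derivativeP Sv js; exact: L2_locint Lw.
have DG j : (j.+1 < s)%N -> forall x : R, is_derive x 1 (G j) (G j.+1 x).
  move=> js x; have [cGj oGj aeGj incGj] := hG j (ltnW js).
  have [cG1 oG1 aeG1 incG1] := hG j.+1 js.
  apply: increment_derive => // a b ab; rewrite incGj//; apply/esym/Rint_ae => //.
    exact: locint_continuous.
  by apply: lw; exact: ltnW.
have dG j : (j < s)%N -> derive1n j v = G j.
  elim: j => [|j IH] js.
    have [cG0 oG0 aeG0 incG0] := hG 0 js.
    by rewrite (Sobolev_chain0 Sv js cv cG0 oG0 aeG0 incG0).
  by rewrite derive1nS IH; [exact: is_derive1_ext (DG j js)|exact: ltnW].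
move=> ks; have [cG oG aeG incG] := hG k ks; rewrite dG//.
have wk := weak_derivativeP Sv (ltnW ks); have wk1 := weak_derivativeP Sv ks.
have [LG nG _] := L2_ae wk.1 oG (continuous_measurable_fun cG) aeG.
have lwk1 := lw _ ks.
split => //.
- move=> x; apply: (le_trans (increment_sup_bound x cG lwk1 incG)).
  rewrite mulr_natl mulr2n; apply: lerD.
    by apply: (le_trans (Rint_le_norm2 x LG)); rewrite nG norm2_le_Sobolev// ltnW.
  by apply: (le_trans (Rint_le_norm2 x wk1.1)); exact: norm2_le_Sobolev.
- by move=> k1 x; have /is_derive1P[] := DG k k1 x.
- move=> XL e e0; have e2 : 0 < e / 2 by rewrite divr_gt0.
  move: wk1 LG lwk1 incG; rewrite XL => wk1 LG lwk1 incG.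
  have [M hM] := Rint_norm_decay LG e2; have [M' hM'] := Rint_norm_decay wk1.1 e2.
  exists (Num.max M M') => x; rewrite gt_max => /andP[/hM h1 /hM' h2].
  have := increment_sup_bound x cG lwk1 incG.
  by move: h1 h2; move: (Rintegral _ _ _) (Rintegral _ _ _); move=> *; lra.
Qed.

(** * Regularity in time *)

Lemma derive1n_lin (R : realType) (n k : nat) (a : R) (f g : R -> R) :
  diffn n f -> diffn n g -> (k <= n)%N ->
  derive1n k (fun x => a * f x + g x) = (fun x => a * derive1n k f x + derive1n k g x).
Proof.
move=> df dg; elim: k => // k IH kn; rewrite !derive1nS IH; last exact: ltnW.
apply: is_derive1_ext => x.
have Df : is_derive x 1 (derive1n k f) (derive1 (derive1n k f) x).
  by apply/is_derive1P; split => //; exact: df.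
have Dg : is_derive x 1 (derive1n k g) (derive1 (derive1n k g) x).
  by apply/is_derive1P; split => //; exact: dg.
exact: is_derive1D.
Qed.

Lemma Sobolev_diffn (R : realType) (X : spatial_domain) (s : nat) (v : R -> R) :
  Sobolev X s.+1 v -> continuous v -> diffn s v.
Proof.
move=> Sv cv k x ks; have ks' : (k < s.+1)%N by exact: ltnW.
by have [_ _ _ dv _] := Sobolev_embedding Sv cv ks'; exact: dv.
Qed.

Lemma Sobolev_lin_bound (R : realType) (X : spatial_domain) (s k : nat) (a : R)
    (f g : R -> R) (x : R) :
  Sobolev X s.+1 f -> Sobolev X s.+1 g -> continuous f -> continuous g -> (k < s.+1)%N ->
  `|a * derive1n k f x + derive1n k g x| <=
    2 * Sobolev_norm X s.+1 (fun x => a * f x + g x).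
Proof.
move=> Sf Sg cf cg ks; have Sh := Sobolev_lin a Sf Sg.
have ch : continuous (fun x => a * f x + g x).
  by move=> y; apply: cvgD; [apply: cvgM; [exact: cvg_cst|exact: cf]|exact: cg].
have [_ _ + _ _] := Sobolev_embedding Sh ch ks.
by rewrite (derive1n_lin a (Sobolev_diffn Sf cf) (Sobolev_diffn Sg cg)).
Qed.

(** The uniformity is in [x]; in time this is continuity at each [t0], relative to [D]. *)
Definition unif_continuous (R : realType) (D : set R) (k : nat) (u : R -> R -> R) : Prop :=
  forall t0, D t0 -> forall e, 0 < e ->
  \forall t \near within D (nbhs t0),
    forall x, `|derive1n k (u t) x - derive1n k (u t0) x| <= e.

Lemma C0_Sobolev_unif (R : realType) (X : spatial_domain) (s k : nat) (T : \bar R)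
    (u : R -> R -> R) :
  C0_Sobolev X s.+1 T u -> (forall t, lifetime T t -> continuous (u t)) ->
  (k < s.+1)%N -> unif_continuous (lifetime T) k u.
Proof.
move=> [Su lim] cu ks t0 Tt0 e e0.
have /cvgrPdist_lt/(_ (e / 2)) := lim t0 Tt0; rewrite divr_gt0// => /(_ isT) near0.
have inD : \forall t \near within (lifetime T) (nbhs t0), lifetime T t.
  by rewrite near_withinE; exact: nearW.
near=> t => x; have Tt : lifetime T t by near: t.
have := @Sobolev_lin_bound R X s k (-1) (u t0) (u t) x (Su _ Tt0) (Su _ Tt)
  (cu _ Tt0) (cu _ Tt) ks.
rewrite mulN1r addrC => /le_trans; apply.
have -> : (fun x => -1 * u t0 x + u t x) = (fun x => u t x - u t0 x).
  by apply/funext => y; rewrite mulN1r addrC.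
have : `|0 - Sobolev_norm X s.+1 (fun x => u t x - u t0 x)| < e / 2 by near: t.
rewrite sub0r normrN => h; have := ler_norm (Sobolev_norm X s.+1 (fun x => u t x - u t0 x)).
by move: h; move: (Sobolev_norm _ _ _) => N; clear; lra.
Unshelve. all: by end_near. Qed.

(** The given time derivative [du] need not be continuous in [x], so [w] takes its continuous
    representative at each time. Sobolev norms ignore null sets, so the limits carry over, and the
    embedding turns them into sup-norm limits. *)
Lemma C1_Sobolev_unif (R : realType) (X : spatial_domain) (s : nat) (T : \bar R)
    (u : R -> R -> R) :
  C1_Sobolev X s.+1 T u -> (forall t, lifetime T t -> continuous (u t)) ->
  exists w : R -> R -> R,
  [/\ forall t, lifetime T t -> continuous (w t),
      forall t, lifetime T t -> Sobolev X s.+1 (w t),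
      forall k, (k < s.+1)%N -> unif_continuous (lifetime T) k w &
      forall k t0, (k < s.+1)%N -> lifetime T t0 -> forall e, 0 < e ->
      \forall t \near within (lifetime T) t0^', forall x,
        `|(t - t0)^-1 * (derive1n k (u t) x - derive1n k (u t0) x) -
          derive1n k (w t0) x| <= e].
Proof.
move=> [[Su _] [du [[Sdu limdu] dudt]]] cu.
have /choice[w hw] : forall t, exists wt : R -> R, lifetime T t ->
    [/\ continuous wt, on_space X wt & {ae @lebesgue_measure R, forall x, wt x = du t x}].
  move=> t; have [Tt|nTt] := pselect (lifetime T t); last by exists (cst 0).
  have [Lf _] := Sdu t Tt; have wf := weak_derivativeP (Sdu t Tt) (ltn0Sn s).
  by have [G [cG oG aeG _]] := continuous_representative Lf wf; exists G.
have cw t : lifetime T t -> continuous (w t) by move=> /hw[].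
have Sw t : lifetime T t -> Sobolev X s.+1 (w t).
  move=> Tt; have [cwt owt aewt] := hw t Tt; apply: Sobolev_ae (Sdu t Tt) owt _ aewt.
  exact: continuous_measurable_fun.
have C0w : C0_Sobolev X s.+1 T w.
  split; first exact: Sw.
  move=> t0 Tt0; apply: cvg_trans (limdu t0 Tt0); apply: near_eq_cvg.
  rewrite near_withinE; apply: nearW => t Tt.
  have [cwt owt aewt] := hw t Tt; have [cw0 ow0 aew0] := hw t0 Tt0.
  apply/esym/Sobolev_norm_ae.
  - rewrite (_ : (fun x => _) = fun x => -1 * du t0 x + du t x).
      exact: L2_lin (Sdu t0 Tt0).1 (Sdu t Tt).1.
    by apply/funext => x; rewrite mulN1r addrC.
  - by case: X owt ow0 {Su Sdu limdu dudt hw Sw} => //= owt ow0 x; rewrite owt ow0.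
  - exact: measurable_funB (continuous_measurable_fun cwt) (continuous_measurable_fun cw0).
  - apply: (@filterS2 _ _ (ae_filter_ringOfSetsType _)) aewt aew0 => x.
    by move=> -> ->.
exists w; split => //; first by move=> k ks; exact: (C0_Sobolev_unif C0w cw ks).
move=> k t0 ks Tt0 e e0.
have /cvgrPdist_lt/(_ (e / 2)) := dudt t0 Tt0; rewrite divr_gt0// => /(_ isT) near0.
have inD : \forall t \near within (lifetime T) t0^', lifetime T t.
  by rewrite near_withinE; exact: nearW.
near=> t => x; have Tt : lifetime T t by near: t.
have [cw0 ow0 aew0] := hw t0 Tt0.
pose r := (t - t0)^-1.
have Sd := Sobolev_lin (-1) (Su t0 Tt0) (Su t Tt).
have cd : continuous (fun x => -1 * u t0 x + u t x).
  by move=> y; apply: cvgD; [apply: cvgM; [exact: cvg_cst|exact: cu]|exact: cu].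
(* With d the increment of [u], the quotient r d is written (r - 1) d + d to fit the shape
   [a * f + g] of the linearity lemmas. *)
have S2 := Sobolev_lin (-1) (Sw t0 Tt0) (Sobolev_lin (r - 1) Sd Sd).
have c2 : continuous (fun x => (r - 1) * (-1 * u t0 x + u t x) + (-1 * u t0 x + u t x)).
  by move=> y; apply: cvgD; [apply: cvgM; [exact: cvg_cst|exact: cd]|exact: cd].
have := @Sobolev_lin_bound R X s k (-1) (w t0) _ x (Sw t0 Tt0) (Sobolev_lin (r - 1) Sd Sd)
  cw0 c2 ks.
rewrite (derive1n_lin (r - 1) (Sobolev_diffn Sd cd) (Sobolev_diffn Sd cd))//.
rewrite (derive1n_lin (-1) (Sobolev_diffn (Su t0 Tt0) (cu _ Tt0))
  (Sobolev_diffn (Su t Tt) (cu _ Tt)))//.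
rewrite [X in `|X| <= _](_ : _ = r * (derive1n k (u t) x - derive1n k (u t0) x) -
  derive1n k (w t0) x); last by ring.
move=> /le_trans; apply.
rewrite (_ : Sobolev_norm _ _ _ = Sobolev_norm X s.+1 (fun x => r * (u t x - u t0 x) - du t0 x)).
  have : `|0 - Sobolev_norm X s.+1
      (fun x => (t - t0)^-1 * (u t x - u t0 x) - du t0 x)| < e / 2 by near: t.
  rewrite -/r sub0r normrN => h.
  have := ler_norm (Sobolev_norm X s.+1 (fun x => r * (u t x - u t0 x) - du t0 x)).
  by move: h; move: (Sobolev_norm _ _ _) => N; clear; lra.
have owt := S2.1.1; have mwt := L2_measurable S2.1.
apply: Sobolev_norm_ae => //.
  rewrite (_ : (fun x => _) = fun x => -1 * du t0 x +
      ((r - 1) * (-1 * u t0 x + u t x) + (-1 * u t0 x + u t x))).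
    exact: (Sobolev_lin (-1) (Sdu t0 Tt0) (Sobolev_lin (r - 1) Sd Sd)).1.
  by apply/funext => y; ring.
apply: (@filterS _ _ (ae_filter_ringOfSetsType _)) aew0 => y ->.
ring.
Unshelve. all: by end_near. Qed.

(** * The nonlocal operator *)

Lemma is_derive_increment (R : realType) (F f : R -> R) (a b : R) : a <= b ->
  (forall x, a <= x <= b -> is_derive x 1 F (f x)) ->
  exists2 c, a <= c <= b & F b - F a = f c * (b - a).
Proof.
move=> ab Ff; have [|x|c cab E] := @MVT_segment R F f a b ab.
- by move=> x /subset_itv_oo_cc; rewrite in_itv/=; exact: Ff.
- apply: derivable_within_continuous => y; rewrite in_itv/= => /Ff/is_derive1P[].
  by [].
- by exists c => //; rewrite in_itv/= in cab.
Qed.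

Lemma is_derive_ge0_le (R : realType) (F f : R -> R) (a b : R) :
  (forall x : R, is_derive x 1 F (f x)) -> (forall x, 0 <= f x) -> a <= b -> F a <= F b.
Proof.
move=> Ff f0 ab; have [c _ E] := is_derive_increment ab (fun x _ => Ff x).
by rewrite -subr_ge0 E mulr_ge0// subr_ge0.
Qed.

(* The equation makes e^(-x) (w + w' - p) an antiderivative of e^(-x) p; it
   vanishes at c and, by boundedness, at infinity. *)
Lemma resolvent_right (R : realType) (w w1 w2 p dp : R -> R) (c B : R) :
  (forall x : R, is_derive x 1 w (w1 x)) -> (forall x : R, is_derive x 1 w1 (w2 x)) ->
  (forall x : R, is_derive x 1 p (dp x)) -> (forall x, w x - w2 x + dp x = 0) ->
  (forall x, [/\ `|w x| <= B, `|w1 x| <= B & `|p x| <= B]) ->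
  w c = 0 -> w1 c = 0 -> p c = 0 -> (forall x, 0 <= p x) ->
  forall x, c <= x -> p x = 0.
Proof.
move=> dw dw1 dpp E bd wc w1c pc p0.
pose K x := expR (- x) * (w x + w1 x - p x).
have dK (x : R) : is_derive x 1 K (expR (- x) * p x).
  have de : is_derive x 1 (fun y => expR (- y)) (expR (- x) * -1).
    by apply: (@is_derive1_chain _ (fun y => - y) expR).
  have dq := is_derive1B (is_derive1D (dw x) (dw1 x)) (dpp x).
  apply: (is_derive_eq (is_derive1M de dq)).
  have := E x; move: (w x) (w1 x) (w2 x) (p x) (dp x) (expR _) => a b d e g h Ex.
  rewrite (_ : g = d - a); first by ring.
  by apply/eqP; rewrite -subr_eq0 -{}[0]Ex; apply/eqP; ring.
have ep x : 0 <= expR (- x) * p x by rewrite mulr_ge0// expR_ge0.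
(* [K] is nondecreasing from [K c = 0], hence nonnegative; it is also at most its value at any later
   [y], bounded by [3 * B * expR (- y)]. *)
have K0 x : c <= x -> K x = 0.
  move=> cx; apply/eqP; rewrite eq_le; apply/andP; split; last first.
    have := is_derive_ge0_le dK ep cx.
    by rewrite {1}/K wc w1c pc addr0 subr0 mulr0.
  apply/ler_addgt0Pr => e e0; rewrite add0r.
  have B0 : 0 <= B by have [h _ _] := bd 0; exact: le_trans h.
  have : expR (- y) @[y --> +oo] --> (0 : R) by exact: cvgr_expR.
  have B1 : 0 < 3 * B + 1 by rewrite ltr_wpDl// mulr_ge0.
  move/cvgrPdist_lt => /(_ (e / (3 * B + 1))); rewrite divr_gt0// => /(_ isT) [M [_ hM]].
  pose y := Num.max x (M + 1).
  have My : M < y by rewrite lt_max ltrDl ltr01 orbT.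
  have xy : x <= y by rewrite le_max lexx.
  apply: (le_trans (is_derive_ge0_le dK ep xy)).
  have := hM y My; rewrite sub0r normrN ger0_norm ?expR_ge0// ltr_pdivlMr// => he.
  have [h1 h2 h3] := bd y.
  apply: le_trans (ltW he); rewrite /K ler_wpM2l ?expR_ge0//.
  by move: h1 h2 h3; rewrite !ler_norml => /andP[_ ?] /andP[_ ?] /andP[? _]; lra.
(* At [c] the claim is a hypothesis; only beyond [c] does [K] vanish on a two-sided neighbourhood,
   as its derivative requires. *)
move=> x; rewrite le_eqVlt => /predU1P[<-//|cx].
have /is_derive1P[_] := dK x; rewrite (@derive1_locally_cst _ _ _ 0); last first.
  by near=> y; apply: K0; apply/ltW; near: y; exact: lt_nbhsr.
by move/esym/eqP; rewrite mulf_eq0 expR_eq0/= => /eqP.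
Unshelve. all: by end_near. Qed.

Definition constant_sign (R : realType) (p : R -> R) : Prop :=
  (forall x, 0 <= p x) \/ (forall x, p x <= 0).

Lemma resolvent_right_sign (R : realType) (w w1 w2 p dp : R -> R) (c B : R) :
  (forall x : R, is_derive x 1 w (w1 x)) -> (forall x : R, is_derive x 1 w1 (w2 x)) ->
  (forall x : R, is_derive x 1 p (dp x)) -> (forall x, w x - w2 x + dp x = 0) ->
  (forall x, [/\ `|w x| <= B, `|w1 x| <= B & `|p x| <= B]) ->
  w c = 0 -> w1 c = 0 -> p c = 0 -> constant_sign p ->
  forall x, c <= x -> p x = 0.
Proof.
move=> dw dw1 dpp E bd wc w1c pc [p0|p0]; first exact: (resolvent_right dw dw1 dpp E bd).
move=> x cx; apply/eqP; rewrite -oppr_eq0; apply/eqP.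
apply: (@resolvent_right _ (fun x => - w x) (fun x => - w1 x) (fun x => - w2 x)
  (fun x => - p x) (fun x => - dp x) c B) => //.
- by move=> y; rewrite -!opprD E oppr0.
- by move=> y; rewrite !normrN.
- by rewrite wc oppr0.
- by rewrite w1c oppr0.
- by rewrite pc oppr0.
- by move=> y; rewrite oppr_ge0.
Qed.

Lemma is_derive1_reflect (R : realType) (F f : R -> R) (x : R) :
  (forall x : R, is_derive x 1 F (f x)) ->
  is_derive x 1 (fun y => F (- y)) (- f (- x)).
Proof.
move=> Ff; rewrite -mulN1r mulrC.
by apply: (@is_derive1_chain _ (fun y => - y) F).
Qed.

(** The reflection x -> -x preserves w - w_xx and reverses the sign of p_x; replacing [p] by its
    opposite restores the equation and reduces the left half-line to the right one. *)
Lemma resolvent_zero (R : realType) (w w1 w2 p dp : R -> R) (c B : R) :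
  (forall x : R, is_derive x 1 w (w1 x)) -> (forall x : R, is_derive x 1 w1 (w2 x)) ->
  (forall x : R, is_derive x 1 p (dp x)) -> (forall x, w x - w2 x + dp x = 0) ->
  (forall x, [/\ `|w x| <= B, `|w1 x| <= B & `|p x| <= B]) ->
  w c = 0 -> w1 c = 0 -> p c = 0 -> constant_sign p ->
  forall x, p x = 0.
Proof.
move=> dw dw1 dpp E bd wc w1c pc sp x.
have [cx|/ltW xc] := leP c x.
  exact: (resolvent_right_sign dw dw1 dpp E bd wc w1c pc sp).
apply/eqP; rewrite -oppr_eq0 -[x in p x]opprK; apply/eqP.
apply: (@resolvent_right_sign _ (fun x => w (- x)) (fun x => - w1 (- x))
  (fun x => w2 (- x)) (fun x => - p (- x)) (fun x => dp (- x)) (- c) B) => //.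
- by move=> y; exact: is_derive1_reflect.
- by move=> y; rewrite -[w2 _]opprK; exact/is_derive1N/is_derive1_reflect.
- by move=> y; rewrite -[dp _]opprK; exact/is_derive1N/is_derive1_reflect.
- by move=> y; have [h1 h2 h3] := bd (- y); rewrite !normrN.
- by rewrite opprK.
- by rewrite opprK w1c oppr0.
- by rewrite opprK pc oppr0.
- by case: sp => sp; [right|left] => y; rewrite ?oppr_le0 ?oppr_ge0.
- by rewrite lerN2.
Qed.

(** * Differentiation in time under the integral sign *)

Lemma is_derive1_quotient (R : realType) (f : R -> R) (t l : R) :
  (forall e, 0 < e -> \forall t' \near t^', `|(t' - t)^-1 * (f t' - f t) - l| <= e) ->
  is_derive t 1 f l.
Proof.
move=> H; suff lim : h^-1 *: (f (h *: 1 + t) - f t) @[h --> 0^'] --> l.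
  by apply: DeriveDef; [apply/cvg_ex; exists l|exact/cvg_lim].
apply/cvgrPdist_le => e e0; have [d /= d0 hd] := H e e0.
exists d => //= h /=; rewrite sub0r normrN => hd' h0.
have := hd (h + t); rewrite /ball_ /= opprD addrCA subrr addr0 normrN => /(_ hd').
rewrite -subr_eq0 addrK => /(_ h0); rewrite distrC.
by rewrite /GRing.scale/= mulr1.
Qed.

(** A quotient error of [e / (b - a)], uniform in [x], integrates to an error of at most [e]. *)
Lemma is_derive_Rint (R : realType) (h : R -> R -> R) (dh : R -> R) (t a b : R) :
  a < b -> continuous dh -> (\forall t' \near t, continuous (h t')) ->
  (forall e, 0 < e -> \forall t' \near t^', forall x,
    `|(t' - t)^-1 * (h t' x - h t x) - dh x| <= e) ->
  is_derive t 1 (fun t' => \int_[a, b] (h t')) (\int_[a, b] dh).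
Proof.
move=> ab cdh ch H; apply: is_derive1_quotient => e e0.
have e1 : 0 < e / (b - a) by rewrite divr_gt0// subr_gt0.
have ct : continuous (h t) by exact: nbhs_singleton ch.
have ch' : \forall t' \near t^', continuous (h t') by exact: nbhs_dnbhs ch.
near=> t'; have ct' : continuous (h t') by near: t'.
have lt' := locint_continuous ct'; have lt := locint_continuous ct.
have ldh := locint_continuous cdh.
have lq := locintZ (t' - t)^-1 (locintB lt' lt).
rewrite -RintegralB//; [|exact: lt'.2|exact: lt.2].
rewrite -RintegralZl//; last exact: (locintB lt' lt).2.
rewrite -RintegralB//; [|exact: lq.2|exact: ldh.2].
apply: (le_trans (le_normr_Rintegral _ ((locintB lq ldh).2 a b))) => //.
apply: (@le_trans _ _ (\int_[a, b] (fun=> e / (b - a)))).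
  apply: (le_Rintegral _ ((locint_norm (locintB lq ldh)).2 a b) ((locint_cst _).2 a b)) => //.
  move=> x _ /=; move: x; near: t'; exact: H.
rewrite Rintegral_cst//= lebesgue_measure_itv/= lte_fin ab -EFinB/=.
by rewrite divfK// gt_eqF// subr_gt0.
Unshelve. all: by end_near. Qed.

(** With q the quotient error, D the increment of A, and a, b the values of A and B, the error for
    squares is 2aq + qD + bD. If |q| and |D| are at most d <= 1, this is at most d (3M + 1). *)
Lemma sqr_quotient (R : realType) (A : R -> R -> R) (B : R -> R) (t M : R) :
  (forall x, `|A t x| <= M) -> (forall x, `|B x| <= M) ->
  (forall e, 0 < e -> \forall t' \near t, forall x, `|A t' x - A t x| <= e) ->
  (forall e, 0 < e -> \forall t' \near t^', forall x,
    `|(t' - t)^-1 * (A t' x - A t x) - B x| <= e) ->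
  forall e, 0 < e -> \forall t' \near t^', forall x,
    `|(t' - t)^-1 * (A t' x ^+ 2 - A t x ^+ 2) - 2 * (A t x * B x)| <= e.
Proof.
move=> AM BM cA dA e e0; have M0 : 0 <= M by exact: le_trans (AM 0).
have M1 : 0 < 3 * M + 1 by rewrite ltr_wpDl// mulr_ge0.
pose d := Num.min 1 (e / (3 * M + 1)).
have d0 : 0 < d by rewrite lt_min ltr01 divr_gt0.
have d1 : d <= 1 by rewrite ge_min lexx.
have de : d * (3 * M + 1) <= e by rewrite -ler_pdivlMr// ge_min lexx orbT.
have h1 := nbhs_dnbhs (cA d d0); have h2 := dA d d0.
near=> t' => x; have k1 : `|A t' x - A t x| <= d by move: x; near: t'.
have k2 : `|(t' - t)^-1 * (A t' x - A t x) - B x| <= d by move: x {k1}; near: t'.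
have -> : (t' - t)^-1 * (A t' x ^+ 2 - A t x ^+ 2) - 2 * (A t x * B x) =
  ((t' - t)^-1 * (A t' x - A t x) - B x) * (2 * A t x) +
  ((t' - t)^-1 * (A t' x - A t x) - B x) * (A t' x - A t x) +
  B x * (A t' x - A t x) by ring.
have := AM x; have := BM x; move: k1 k2.
move: ((t' - t)^-1 * (A t' x - A t x) - B x) => q.
move: (A t' x - A t x) => D; move: (A t x) (B x) => a b kD kq kb ka.
apply: le_trans de; apply: (le_trans (ler_normD _ _)).
have n1 : `|b * D| <= M * d by rewrite normrM ler_pM.
have n2 : `|q * (2 * a)| <= d * (2 * M).
  by rewrite normrM ler_pM// normrM ger0_norm// ler_wpM2l.
have n3 : `|q * D| <= d * 1.
  by rewrite normrM ler_pM// (le_trans kD).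
have := ler_normD (q * (2 * a)) (q * D); lra.
Unshelve. all: by end_near. Qed.

(** * Classical solutions and the energy *)

Lemma continuous_bounded_itv (R : realType) (f : R -> R) (M : R) : continuous f ->
  exists2 C, 0 <= C & forall y, `|y| <= M -> `|f y| <= C.
Proof.
move=> cf; have [M0|M0] := leP 0 M; last first.
  by exists 0 => // y /(le_lt_trans)/(_ M0); rewrite normr_lt0.
have cn : continuous (fun x => `|f x|).
  by move=> x; apply: continuous_comp; [exact: cf|exact: norm_continuous].
have MM : - M <= M by lra.
have [c _ hc] := @EVT_max R (fun x => `|f x|) (- M) M MM (continuous_subspaceT cn).
by exists `|f c| => // y yM; apply: hc; rewrite in_itv/= -ler_norml.
Qed.

(** The times at which the equation is imposed and the time derivative is two-sided. *)
Definition interior_time (R : realType) (T : \bar R) (t : R) : Prop :=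
  0 < t /\ (t%:E < T)%E.

Lemma interior_lifetime (R : realType) (T : \bar R) (t : R) :
  interior_time T t -> lifetime T t.
Proof. by move=> [t0 tT]; split => //; exact: ltW. Qed.

Lemma ereal_real_bound (R : realType) (T : \bar R) (t : R) : (t%:E < T)%E ->
  exists r : R, t < r /\ (r%:E <= T)%E.
Proof.
case: T => [r| |] tT //; first by exists r; rewrite lte_fin in tT; split.
by exists (t + 1); rewrite ltrDl leey.
Qed.

Lemma interior_time_nbhs (R : realType) (T : \bar R) (t : R) : interior_time T t ->
  \forall t' \near t, interior_time T t'.
Proof.
move=> [t0 tT]; have [r [tr rT]] := ereal_real_bound tT.
near=> t'; split; first by near: t'; exact: lt_nbhsr.
by apply: lt_le_trans rT; rewrite lte_fin; near: t'; exact: lt_nbhsl.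
Unshelve. all: by end_near. Qed.

Lemma interior_time_itv (R : realType) (T : \bar R) (a b t : R) :
  interior_time T a -> interior_time T b -> a <= t <= b -> interior_time T t.
Proof.
move=> [a0 _] [_ bT] /andP[at_ tb]; split; first exact: lt_le_trans at_.
by apply: le_lt_trans bT; rewrite lee_fin.
Qed.

(* [w] is the continuous representative of the time derivative of [u]. *)
Record classical_solution (R : realType) (X : spatial_domain) (f : R -> R) (T : \bar R)
    (u w : R -> R -> R) : Prop := ClassicalSolution {
  sol_cont : forall t, lifetime T t -> continuous (u t);
  sol_H4 : forall t, lifetime T t -> Sobolev X 4 (u t);
  vel_cont : forall t, lifetime T t -> continuous (w t);
  vel_H3 : forall t, lifetime T t -> Sobolev X 3 (w t);
  sol_unif : forall k, (k < 4)%N -> unif_continuous (lifetime T) k u;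
  vel_unif : forall k, (k < 3)%N -> unif_continuous (lifetime T) k w;
  sol_derive : forall k t, (k < 3)%N -> interior_time T t -> forall e, 0 < e ->
    \forall t' \near t^', forall x,
      `|(t' - t)^-1 * (derive1n k (u t') x - derive1n k (u t) x) - derive1n k (w t) x| <= e;
  sol_eqn : forall t x, interior_time T t ->
    w t x - derive1n 2 (w t) x + derive1 (f \o u t) x = 0
}.

(** At order 0 the uniform limit of quotients is a pointwise derivative, which identifies [derive1]
    in time with [w]. Near an interior time all times lie in the lifetime, so restricted limits
    become full ones. *)
Lemma is_solution_classical (R : realType) (X : spatial_domain) (f u0 : R -> R)
    (T : \bar R) (u : R -> R -> R) :
  is_solution X f u0 T u -> exists w, classical_solution X f T u w.
Proof.
move=> [T0 [C4 C1] cu eqn _]; have [w [cw Sw Uw Dw]] := C1_Sobolev_unif C1 cu.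
have D k t : (k < 3)%N -> interior_time T t -> forall e, 0 < e ->
    \forall t' \near t^', forall x,
      `|(t' - t)^-1 * (derive1n k (u t') x - derive1n k (u t) x) - derive1n k (w t) x| <= e.
  move=> k3 It e e0; have := Dw k t k3 (interior_lifetime It) e e0.
  rewrite near_withinE => h; near=> t'.
  have It' : interior_time T t' by near: t'; apply: nbhs_dnbhs; exact: interior_time_nbhs.
  by move: (interior_lifetime It'); near: t'.
exists w; split => //.
- exact: C4.1.
- by move=> k k4; exact: (C0_Sobolev_unif C4 cu k4).
- move=> t x It; have := eqn t x It.1 It.2.
  have -> : (fun y => derive1 (fun t' => u t' y) t) = w t; last by [].
  apply/funext => y; suff /is_derive1P[] : is_derive t 1 (fun t' => u t' y) (w t y) by [].
  apply: is_derive1_quotient => e e0; have := D 0 t isT It e e0.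
  by apply: filterS => t' /(_ y).
Unshelve. all: by end_near. Qed.

Section solution.
Context {R : realType} (X : spatial_domain) (f : R -> R) (T : \bar R) (u w : R -> R -> R).
Hypothesis f_diff : forall x : R, derivable f x 1.
Hypothesis f_sign : constant_sign f.
Hypothesis f_zero : forall x : R, f x = 0 <-> x = 0.
Hypothesis uw : classical_solution X f T u w.

Let f_cont : continuous f.
Proof. by move=> x; apply/differentiable_continuous/derivable1_diffP. Qed.

Let U k t := derive1n k (u t).
Let W k t := derive1n k (w t).

Let U_embed k t (It : interior_time T t) (k4 : (k < 4)%N) :=
  Sobolev_embedding (sol_H4 uw (interior_lifetime It)) (sol_cont uw (interior_lifetime It)) k4.
Let W_embed k t (It : interior_time T t) (k3 : (k < 3)%N) :=
  Sobolev_embedding (vel_H3 uw (interior_lifetime It)) (vel_cont uw (interior_lifetime It)) k3.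

Let dU k t (x : R) : interior_time T t -> (k.+1 < 4)%N -> is_derive x 1 (U k t) (U k.+1 t x).
Proof.
move=> It k4; have [_ _ _ d _] := U_embed It (ltnW k4).
by apply/is_derive1P; split; [exact: d|].
Qed.

Let dW k t (x : R) : interior_time T t -> (k.+1 < 3)%N -> is_derive x 1 (W k t) (W k.+1 t x).
Proof.
move=> It k3; have [_ _ _ d _] := W_embed It (ltnW k3).
by apply/is_derive1P; split; [exact: d|].
Qed.

Let cU k t : interior_time T t -> (k < 4)%N -> continuous (U k t).
Proof. by move=> It k4; have [] := U_embed It k4. Qed.

Let cW k t : interior_time T t -> (k < 3)%N -> continuous (W k t).
Proof. by move=> It k3; have [] := W_embed It k3. Qed.

Let dp t (x : R) : interior_time T t ->
  is_derive x 1 (fun y => f (U 0 t y)) (derive1 (f \o u t) x).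
Proof.
move=> It; have df : is_derive (U 0 t x) 1 f (derive1 f (U 0 t x)) by exact/is_derive1P.
have D := @is_derive1_chain _ (U 0 t) f x _ _ (dU x It (isT : (1 < 4)%N)) df.
by have /is_derive1P[D1 _] := D; apply/is_derive1P.
Qed.

Let bounded_at t : interior_time T t -> exists2 M, 0 <= M &
  forall x, [/\ `|U 0 t x| <= M, `|U 1 t x| <= M, `|W 0 t x| <= M & `|W 1 t x| <= M].
Proof.
move=> It; have [_ _ b0 _ _] := U_embed It (isT : (0 < 4)%N).
have [_ _ b1 _ _] := U_embed It (isT : (1 < 4)%N).
have [_ _ b2 _ _] := W_embed It (isT : (0 < 3)%N).
have [_ _ b3 _ _] := W_embed It (isT : (1 < 3)%N).
exists (Num.max (2 * Sobolev_norm X 4 (u t)) (2 * Sobolev_norm X 3 (w t))).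
  by rewrite le_max mulr_ge0// sqrtr_ge0.
move=> x; split; rewrite le_max; apply/orP.
- by left; exact: b0.
- by left; exact: b1.
- by right; exact: b2.
- by right; exact: b3.
Qed.

(** As [w t] vanishes on a neighbourhood of [xi], so does its derivative at [xi], which completes
    the boundary data there. The conclusion f(u) = 0 then gives u = 0 by [f_zero]. *)
Lemma vanishing_slice (t xi d : R) : interior_time T t -> 0 < d ->
  (forall t' x, `|t' - t| < d -> `|x - xi| < d -> u t' x = 0) ->
  forall x, u t x = 0.
Proof.
move=> It d0 u_zero x.
have w_zero y : `|y - xi| < d -> w t y = 0.
  move=> yd; suff D : is_derive t 1 (fun t' => u t' y) (w t y).
    have /is_derive1P[_ <-] := D; apply: (@derive1_locally_cst _ _ _ 0).
    near=> t'; apply: u_zero => //; rewrite distrC; near: t'.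
  apply: is_derive1_quotient => e e0; have := sol_derive uw (isT : (0 < 3)%N) It e0.
  by apply: filterS => t' /(_ y).
have xi0 : `|xi - xi| < d by rewrite subrr normr0.
have [M M0 hM] := bounded_at It.
have [C C0 hC] := @continuous_bounded_itv R f M f_cont.
have near_xi : \forall y \near xi, w t y = 0.
  near=> y; apply: w_zero; rewrite distrC; near: y.
  exact: nbhsx_ballx.
(* [M] bounds w and w_x, and [C] bounds [f] on the range of [u t]; the sum is a common bound. *)
apply: (f_zero (u t x)).1; apply: (@resolvent_zero _ (W 0 t) (W 1 t) (W 2 t) (fun y => f (U 0 t y))
    (derive1 (f \o u t)) xi (M + C)).
- by move=> y; exact: dW.
- by move=> y; exact: dW.
- by move=> y; exact: dp.
- by move=> y; exact: (sol_eqn uw y It).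
- move=> y; have [h1 h2 h3 h4] := hM y; split.
  + by rewrite (le_trans h3)// lerDl.
  + by rewrite (le_trans h4)// lerDl.
  + by rewrite (le_trans (hC _ h1))// lerDr.
- exact: w_zero.
- exact: (derive1_locally_cst near_xi).
- by rewrite /U /= u_zero//; [exact: (f_zero 0).2|rewrite subrr normr0].
- by case: f_sign => fs; [left|right] => y; exact: fs.
Unshelve. all: by end_near. Qed.

(* [flux] is the x-antiderivative of the time derivative of u^2 + (u_x)^2:
   here (f o u)_x = w_xx - w, and u (f o u)_x is itself an x-derivative. *)
Let flux t x := 2 * (U 0 t x * W 1 t x) - 2 * (U 0 t x * f (U 0 t x) - prim f (U 0 t x)).

Let energy (N t : R) := \int_[- N, N] (fun x => U 0 t x ^+ 2) +
                        \int_[- N, N] (fun x => U 1 t x ^+ 2).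

Let d_prim (y : R) : is_derive y 1 (prim f) (f y).
Proof.
apply: increment_derive => // a b ab.
exact/prim_increment/ab/locint_continuous.
Qed.

Let d_flux t (x : R) : interior_time T t ->
  is_derive x 1 (flux t) (2 * (U 0 t x * W 0 t x) + 2 * (U 1 t x * W 1 t x)).
Proof.
move=> It; have d0 := dU x It (isT : (1 < 4)%N); have d1 := dW x It (isT : (2 < 3)%N).
have dF := @is_derive1_chain _ (U 0 t) (prim f) x _ _ d0 (d_prim (U 0 t x)).
have dd := is_derive1B (is_derive1M (is_derive_cst (2 : R) x 1) (is_derive1M d0 d1))
  (is_derive1M (is_derive_cst (2 : R) x 1)
    (is_derive1B (is_derive1M d0 (dp x It)) dF)).
apply: (is_derive_eq dd); have E := sol_eqn uw x It.
(* The two terms f(u) u_x cancel, and the equation eliminates the remaining (f o u)_x. *)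
have -> : W 0 t x = W 2 t x - derive1 (f \o u t) x.
  by apply/eqP; rewrite -subr_eq0 -[X in _ == X]E; apply/eqP; rewrite /W /=; ring.
by rewrite /cst; ring.
Qed.

Let sqr_continuous (g : R -> R) : continuous g -> continuous (fun x => g x ^+ 2).
Proof. by move=> cg x; apply: cvgM; exact: cg. Qed.

(** Differentiation under the integral produces the x-derivative of [flux], which is continuous and
    so integrates to the boundary values. *)
Let d_energy (N t : R) : 0 < N -> interior_time T t ->
  is_derive t 1 (energy N) (flux t N - flux t (- N)).
Proof.
move=> N0 It; have NN : - N < N by lra.
have [M M0 hM] := bounded_at It.
have It' := interior_time_nbhs It.
have unif k : (k < 4)%N -> forall e, 0 < e ->
    \forall t' \near t, forall x, `|U k t' x - U k t x| <= e.
  move=> k4 e e0; have := sol_unif uw k4 (interior_lifetime It) e0.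
  rewrite near_withinE => h; near=> t'.
  have i : interior_time T t' by near: t'.
  by move: (interior_lifetime i); near: t'.
have part k : (k < 2)%N -> is_derive t 1 (fun t' => \int_[- N, N] (fun x => U k t' x ^+ 2))
    (\int_[- N, N] (fun x => 2 * (U k t x * W k t x))).
  move=> k2; have k3 : (k < 3)%N by exact: leq_trans k2 _.
  have k4 : (k < 4)%N by exact: leq_trans k2 _.
  apply: (is_derive_Rint (h := fun t' x => U k t' x ^+ 2)) => //.
  - move=> x; apply: cvgM; first exact: cvg_cst.
    by apply: cvgM; [exact: cU|exact: cW].
  - by apply: filterS It' => t' It1; apply: sqr_continuous; exact: cU.
  - apply: (@sqr_quotient _ _ _ _ M) => //.
    + by case: k k2 {k3 k4} => [|[|]]// _ x; have [] := hM x.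
    + by case: k k2 {k3 k4} => [|[|]]// _ x; have [] := hM x.
    + exact: unif.
    + exact: (sol_derive uw k3 It).
have c2 k : (k < 2)%N -> continuous (fun x => 2 * (U k t x * W k t x)).
  move=> k2 x; apply: cvgM; first exact: cvg_cst.
  by apply: cvgM; [apply: cU => //; exact: leq_trans k2 _|apply: cW => //; exact: leq_trans k2 _].
apply: (is_derive_eq (is_derive1D (part 0 isT) (part 1%N isT))).
have l0 := locint_continuous (c2 0 isT); have l1 := locint_continuous (c2 1%N isT).
rewrite -RintegralD//; [|exact: l0.2|exact: l1.2].
apply: (Rint_FTC (F := flux t)); first exact: ltW.
  by move=> x; exact: d_flux.
by move=> x; apply: cvgD; [exact: c2|exact: c2].
Unshelve. all: by end_near. Qed.

(** The mean value theorem between 0 and [y]; the factor [|y|] makes this part of the flux decay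
    with u. *)
Let prim_le (C M y : R) : (forall z, `|z| <= M -> `|f z| <= C) -> `|y| <= M ->
  `|prim f y| <= C * `|y|.
Proof.
move=> hC yM; have p0 : prim f 0 = 0 by rewrite /prim subrr.
have [y0|/ltW y0] := leP 0 y.
  have [c /andP[c0 cy]] := is_derive_increment y0 (fun x _ => d_prim x).
  rewrite p0 !subr0 => ->; rewrite normrM ler_wpM2r// hC//.
  by rewrite ger0_norm// (le_trans cy)// (le_trans (ler_norm _)).
have [c /andP[c0 cy]] := is_derive_increment y0 (fun x _ => d_prim x).
rewrite p0 !sub0r mulrN => /oppr_inj ->; rewrite normrM ler_wpM2r// hC//.
by rewrite ler0_norm// (le_trans _ yM)// ler0_norm// lerN2.
Qed.

(** Every term of [flux] is at most a constant times |u|, so on the line the decay of u suffices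
    while w_x is merely bounded. On the circle the values at N and -N both equal the value at 0. *)
Let flux_small (a b e : R) : interior_time T a -> interior_time T b -> 0 < e ->
  \forall N \near \oo, forall s, a <= s <= b -> `|flux s N%:R - flux s (- N%:R)| <= e.
Proof.
move=> Ia Ib e0.
(* By compactness it suffices to find, for each time [s], a threshold for [N] valid at all times
   near [s]. *)
have := (compact_near_coveringP _).1 (@segment_compact R a b) nat \oo
  (fun N s => `|flux s N%:R - flux s (- N%:R)| <= e) _.
case=> [s sab|N _ hN]; last first.
  by exists N => // n Nn s sab; apply: (hN n Nn); rewrite /= in_itv.
have Is : interior_time T s by apply: interior_time_itv Ia Ib _; move: sab; rewrite /= in_itv.
have It' := interior_time_nbhs Is.
have periodic_flux s' : X = Circle -> interior_time T s' -> forall N : nat,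
    flux s' N%:R - flux s' (- N%:R) = 0.
  move=> XC Is' N; have [_ o0 _ _ _] := U_embed Is' (isT : (0 < 4)%N).
  have [_ o1 _ _ _] := W_embed Is' (isT : (1 < 3)%N).
  rewrite XC /= in o0 o1.
  have sym (H : R -> R) : (forall x, H (x + 1) = H x) -> H N%:R = H (- N%:R).
    move=> pH; have E1 := periodic_int N%:Z 0 pH; have E2 := periodic_int (- N%:Z) 0 pH.
    by rewrite !add0r mulrNz in E1 E2; rewrite E2 -E1.
  by rewrite /flux (sym (U 0 s') o0) (sym (W 1 s') o1) subrr.
case: (pselect (X = Circle)) => [XC|XL].
  near=> s' N; rewrite periodic_flux ?normr0 ?ltW//.
  by near: s'.
have {}XL : X = Line by case: X XL.
have [M M0 hM] := bounded_at Is.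
have [C C0 hC] := @continuous_bounded_itv R f (M + 1) f_cont.
(* The flux is at most [L] times |u|: [2 * (M + 1)] comes from w_x, [4 * C] from f(u) and its
   primitive. The bound [M + 1] allows for a drift of at most 1 from time [s]. With |u| at most
   [2 * d], each endpoint contributes at most [e / 2]. *)
pose L := 2 * (M + 1) + 4 * C + 1.
have L0 : 0 < L by rewrite /L; lra.
pose d := Num.min 1 (e / (4 * L)).
have d0 : 0 < d by rewrite lt_min ltr01 divr_gt0// mulr_gt0.
have d1 : d <= 1 by rewrite ge_min lexx.
have de : d * (4 * L) <= e by rewrite -ler_pdivlMr ?mulr_gt0// ge_min lexx orbT.
have Uunif := sol_unif uw (isT : (0 < 4)%N) (interior_lifetime Is) d0.
have Wunif := vel_unif uw (isT : (1 < 3)%N) (interior_lifetime Is) ltr01.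
rewrite !near_withinE in Uunif Wunif.
have [_ _ _ _ /(_ XL d d0)[K hK]] := U_embed Is (isT : (0 < 4)%N).
have flux_le s' x : interior_time T s' ->
    (forall x, `|U 0 s' x - U 0 s x| <= d) -> (forall x, `|W 1 s' x - W 1 s x| <= 1) ->
    K < `|x| -> `|flux s' x| <= e / 2.
  move=> Is' hu hw /hK Ux; have [h1 _ _ h4] := hM x.
  have u1 : `|U 0 s' x| <= 2 * d.
    have := ler_normD (U 0 s' x - U 0 s x) (U 0 s x); rewrite subrK.
    have := hu x; have := ltW Ux; rewrite /U /=; lra.
  have u2 : `|U 0 s' x| <= M + 1.
    have := ler_normD (U 0 s' x - U 0 s x) (U 0 s x); rewrite subrK.
    have := hu x; lra.
  have w1 : `|W 1 s' x| <= M + 1.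
    have := ler_normD (W 1 s' x - W 1 s x) (W 1 s x); rewrite subrK.
    have := hw x; lra.
  have f1 := hC _ u2; have F1 := prim_le hC u2.
  rewrite /flux; move: (U 0 s' x) (W 1 s' x) u1 u2 w1 f1 F1 => y z u1 u2 w1 f1 F1.
  have n1 : `|2 * (y * z)| <= 2 * (`|y| * (M + 1)).
    by rewrite !normrM ger0_norm// !ler_wpM2l.
  have n2 : `|2 * (y * f y - prim f y)| <= 2 * (`|y| * C + C * `|y|).
    rewrite normrM ger0_norm// ler_wpM2l// (le_trans (ler_normB _ _))// lerD//.
    by rewrite normrM ler_wpM2l.
  apply: (le_trans (ler_normB _ _)); apply: (le_trans (lerD n1 n2)).
  have n3 : `|y| * L <= 2 * d * L by rewrite ler_wpM2r// ltW.
  have : 2 * (`|y| * (M + 1)) + 2 * (`|y| * C + C * `|y|) <= `|y| * L.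
    rewrite [leRHS](_ : _ = 2 * (`|y| * (M + 1)) + 2 * (`|y| * C + C * `|y|) + `|y|).
      by rewrite lerDl.
    by rewrite /L; ring.
  lra.
near=> s' N.
have Is' : interior_time T s' by near: s'.
have hu x : `|U 0 s' x - U 0 s x| <= d.
  by move: x; apply: (near Uunif) => //; exact: interior_lifetime.
have hw x : `|W 1 s' x - W 1 s x| <= 1.
  by move: x; apply: (near Wunif) => //; exact: interior_lifetime.
have KN : K < `|N%:R : R|.
  rewrite ger0_norm//; near: N; exact: nbhs_infty_gtr.
have h1 := flux_le s' N%:R Is' hu hw KN.
have h2 := flux_le s' (- N%:R) Is' hu hw; rewrite normrN in h2.
apply: (le_trans (ler_normB _ _)); have := h2 KN; lra.
Unshelve. all: by end_near. Qed.

(** The mean value theorem in time bounds the change of energy by the flux difference times the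
    elapsed time; ordering the two times as [a] and [b] covers both directions. *)
Lemma energy_zero (t0 t x : R) : interior_time T t0 -> interior_time T t ->
  (forall x, u t0 x = 0) -> u t x = 0.
Proof.
move=> I0 It u0.
pose a := Num.min t t0; pose b := Num.max t t0.
have Ia : interior_time T a by rewrite /a; case: leP.
have Ib : interior_time T b by rewrite /b; case: leP.
have ab : a <= b by rewrite ge_min le_max lexx.
have U0 : U 0 t0 = cst 0 by apply/funext => y; exact: u0.
have U1 : U 1 t0 = cst 0.
  by rewrite /U derive1n1; apply: is_derive1_ext => y; rewrite -[u t0]/(U 0 t0) U0;
    exact: is_derive_cst.
have energy0 N : energy N t0 = 0.
  rewrite /energy U0 U1 /cst expr0n /=.
  by rewrite /Rintegral integral0 addr0.
have cU2 : continuous (fun y => U 0 t y ^+ 2) by apply: sqr_continuous; exact: cU.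
have l2 := locint_continuous cU2.
have lU1 : locint (fun y => U 1 t y ^+ 2).
  by apply: locint_continuous; apply: sqr_continuous; exact: cU.
(* The window [-r, r] stays fixed while the energy interval [-N, N] grows with [N] depending on [e];
   only the u^2 part over the window is kept. *)
have energy_small e r : 0 <= r -> 0 < e -> \int_[- r, r] (fun y => U 0 t y ^+ 2) <= e * (b - a).
  move=> r0 e0; have small := flux_small Ia Ib e0.
  near \oo => N.
  have hN : forall s, a <= s <= b -> `|flux s N%:R - flux s (- N%:R)| <= e by near: N.
  have rN : `|r| < N%:R by near: N; exact: nbhs_infty_gtr.
  have N0 : 0 < N%:R :> R by exact: le_lt_trans rN.
  have le1 : \int_[- r, r] (fun y => U 0 t y ^+ 2) <= energy N%:R t.
    have rN' : r <= N%:R by exact: le_trans (ler_norm _) (ltW rN).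
    rewrite /energy (@Rint_chasles _ _ (- N%:R) (- r) N%:R)//; last first.
      by apply/andP; split; lra.
    rewrite (@Rint_chasles _ _ (- r) r N%:R)//; last by apply/andP; split; lra.
    rewrite addrC addrA addrCA lerDl.
    by rewrite !addr_ge0//; apply: Rintegral_ge0 => y _; exact: sqr_ge0.
  apply: (le_trans le1).
  have [c cab E] := is_derive_increment ab
    (fun s sab => d_energy N0 (interior_time_itv Ia Ib sab)).
  have : `|energy N%:R b - energy N%:R a| <= e * (b - a).
    by rewrite E normrM (ger0_norm (_ : 0 <= b - a)) ?subr_ge0// ler_wpM2r ?subr_ge0// hN.
  rewrite /b /a; case: (leP t t0) => _; rewrite energy0 ?subr0 ?sub0r ?normrN.
    by apply: le_trans; exact: ler_norm.
  by apply: le_trans; exact: ler_norm.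
have zero r : 0 <= r -> \int_[- r, r] (fun y => U 0 t y ^+ 2) = 0.
  move=> r0; apply/eqP; rewrite eq_le; apply/andP; split; last first.
    by apply: Rintegral_ge0 => y _; exact: sqr_ge0.
  apply/ler_addgt0Pr => e e0; rewrite add0r.
  (* The added 1 keeps the divisor positive when the two times coincide. *)
  have ba : 0 < b - a + 1 by rewrite ltr_wpDl// subr_ge0.
  apply: (le_trans (energy_small (e / (b - a + 1)) r r0 (divr_gt0 e0 ba))).
  by rewrite mulrAC ler_pdivrMr// ler_pM2l// lerDl.
(* [x] lies strictly inside [-r, r], where the primitive of u^2 is constant; its derivative at [x]
   is the square sought. *)
pose r := `|x| + 1; pose h y := U 0 t y ^+ 2.
have dh (y : R) : is_derive y 1 (prim h) (h y).
  by apply: increment_derive => // c d cd; exact: prim_increment.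
have flat_prim y : - r <= y <= r -> prim h y = prim h r.
  move=> /andP[ry yr]; have r0 : - r <= r by exact: le_trans yr.
  have E : prim h r = prim h (- r).
    by apply/eqP; rewrite -subr_eq0 prim_increment// zero// addr_ge0.
  have h0 z : 0 <= h z by exact: sqr_ge0.
  apply/eqP; rewrite eq_le (is_derive_ge0_le dh h0 yr)/= E.
  exact: (is_derive_ge0_le dh h0 ry).
have [xr1 xr2] : - r < x /\ x < r.
  by split; rewrite /r; have := ler_norm x; have := ler_norm (- x); rewrite normrN; lra.
have /is_derive1P[_] := dh x; rewrite (@derive1_locally_cst _ _ _ (prim h r)).
  by move/esym/eqP; rewrite sqrf_eq0 => /eqP.
near=> y; apply: flat_prim; apply/andP; split; apply/ltW; near: y.
  exact: lt_nbhsr.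
exact: lt_nbhsl.
Unshelve. all: by end_near. Qed.

End solution.

(** * From the open set to the whole solution *)

(** The given point of [Omega] may lie at time 0, so the centre is moved forward from [tau] to a
    later [t0] with room on both sides. *)
Lemma open_vanishing_interior (R : realType) (X : spatial_domain) (T : \bar R)
    (Omega : set (R * R)) (u : R -> R -> R) :
  open_in_spacetime X T Omega -> Omega !=set0 -> (forall t x, Omega (t, x) -> u t x = 0) ->
  exists t0 xi d, [/\ interior_time T t0, 0 < d &
    forall t x, `|t - t0| < d -> `|x - xi| < d -> u t x = 0].
Proof.
move=> [[V [oV ->]] _] [[tau xi] [Vp [[tau0 tauT] _]]] u_zero.
have [e /= e0 eV] : nbhs_ball (tau, xi) V.
  by apply/nbhs_ballP; exact: open_nbhs_nbhs.
have {}e0 : (0 : R) < e by [].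
have {}tau0 : (0 : R) <= tau by [].
rewrite /= in tauT.
have [r [taur rT]] := ereal_real_bound tauT.
pose t0 := Num.min ((tau + r) / 2) (tau + e / 2).
have t0e : t0 <= tau + e / 2 by rewrite ge_min lexx orbT.
have t0r : t0 <= (tau + r) / 2 by rewrite ge_min lexx.
have taut0 : tau < t0 by rewrite lt_min; apply/andP; split; lra.
(* Three constraints: remain in the ball of radius [e], given that [t0] is within [e / 2] of [tau];
   remain after [tau]; remain before [r], a real bound below [T]. *)
pose d := Num.min (e / 2) (Num.min (t0 - tau) (r - t0)).
have d1 : d <= e / 2 by rewrite ge_min lexx.
have d2 : d <= t0 - tau by rewrite !ge_min lexx orbT.
have d3 : d <= r - t0 by rewrite !ge_min lexx !orbT.
exists t0, xi, d; split.
- split; first exact: le_lt_trans taut0.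
  by apply: lt_le_trans rT; rewrite lte_fin; lra.
- by rewrite !lt_min !subr_gt0 taut0 divr_gt0//=; lra.
- move=> t x; rewrite !ltr_norml => /andP[h1 h2] /andP[h3 h4]; apply: u_zero; split.
    apply: eV; split; rewrite /ball /= ltr_norml; apply/andP; split; lra.
  split => //; split; first by rewrite /=; lra.
  by apply: lt_le_trans rT; rewrite lte_fin /=; lra.
Qed.

Theorem theorem1p1 (R : realType) (X : spatial_domain)
    (f : R -> R)
    (f_diff : forall x : R, derivable f x 1)
    (f_sign : (forall x : R, 0 <= f x) \/ (forall x : R, f x <= 0))
    (f_zero : forall x : R, f x = 0 <-> x = 0)
    (u0 : R -> R) (u0_H4 : Sobolev X 4 u0) (u0_cont : continuous u0)
    (T : \bar R) (u : R -> R -> R)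
    (u_sol : is_unique_maximal_solution X f u0 T u)
    (Omega : set (R * R)) (Omega_open : open_in_spacetime X T Omega)
    (Omega_nonempty : Omega !=set0)
    (u_zero : forall t x : R, Omega (t, x) -> u t x = 0) :
  forall t x : R, lifetime T t -> u t x = 0.
Proof.
have [w uw] := is_solution_classical u_sol.1.
have [t0 [xi [d [I0 d0 u_ball]]]] := open_vanishing_interior Omega_open Omega_nonempty u_zero.
have u_t0 := vanishing_slice f_diff f_sign f_zero uw I0 d0 u_ball.
have u_int t x : interior_time T t -> u t x = 0.
  by move=> It; exact: (energy_zero f_diff uw x I0 It u_t0).
move=> t x Tt; have [t_ge0 tT] := Tt.
(* Only time 0 remains; continuity in time compares it with an interior time [t1]. *)
move: t_ge0; rewrite le_eqVlt => /predU1P[t_eq0|t_gt0]; last exact: u_int.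
apply/eqP; rewrite -normr_le0; apply/ler_addgt0Pr => e e0; rewrite add0r.
have := sol_unif uw (isT : (0 < 4)%N) Tt e0.
rewrite near_withinE => /nbhs_ballP[r /= r0 hr].
have [s [ts sT]] := ereal_real_bound tT.
(* Later than [t], within the radius of continuity, and before the real bound [s]. *)
pose t1 := t + Num.min (r / 2) ((s - t) / 2).
have h1 : Num.min (r / 2) ((s - t) / 2) <= r / 2 by rewrite ge_min lexx.
have h2 : Num.min (r / 2) ((s - t) / 2) <= (s - t) / 2 by rewrite ge_min lexx orbT.
have h3 : 0 < Num.min (r / 2) ((s - t) / 2) by rewrite lt_min !divr_gt0// subr_gt0.
have I1 : interior_time T t1.
  split; first by rewrite /t1; lra.
  by apply: lt_le_trans sT; rewrite lte_fin /t1; lra.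
have := hr t1 _ (interior_lifetime I1) x.
rewrite /= u_int// sub0r normrN; apply.
by rewrite /ball /= /t1 opprD addrA subrr sub0r normrN gtr0_norm; lra.
Qed.
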